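(* Given any $\varepsilon>0$ and integer $k\ge 2$, there exist $0<\alpha,\xi<\varepsilon$ and $n_0\in\mathbb{N}$ such that the following holds. Suppose that $H$ is a $k$-uniform hypergraph on $n\ge n_0$ vertices. If $$\delta_1(H)\ge\left(\frac12-\alpha\right)\binom{n-1}{k-1},$$ then $H$ is $\varepsilon$-close to $\mathcal{B}_{n,k}$ or $\overline{\mathcal{B}}_{n,k}$, or $H$ contains a matching $M$ of size $|M|\le \xi n/k$ that absorbs any set $W\subseteq V(H)\setminus V(M)$ such that $|W|\in k\mathbb{N}$ and $|W|\le \xi^2 n$.
   Context: $\mathbb{N}$ is the set of positive integers and $k\mathbb{N}$ the set of positive multiples of $k$. A $k$-uniform hypergraph $H$ consists of a finite vertex set $V(H)$ and a set $E(H)$ of $k$-element subsets of $V(H)$ (edges). $\delta_1(H)$ is the minimum, over vertices $v$, of the number of edges containing $v$. A matching $M$ is a set of pairwise disjoint edges, $|M|$ is its number of edges, and $V(M)$ is the set of vertices it covers; it is perfect in a hypergraph if it covers all its vertices. For $X\subseteq V(H)$, $H[X]$ is the subhypergraph induced by $X$, with vertex set $X$ and edge set $E(H)\cap\binom{X}{k}$. A matching $M$ in $H$ absorbs a set $W\subseteq V(H)\setminus V(M)$ if $H[V(M)\cup W]$ contains a perfect matching. Given an $n$-set $V$ partitioned into $A,B$ with $|A|=\lfloor n/2\rfloor$ and $|B|=\lceil n/2\rceil$, $\mathcal{B}_{n,k}$ is the $k$-uniform hypergraph on $V$ whose edges are all $k$-subsets of $V$ meeting $A$ in an odd number of vertices,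 and $\overline{\mathcal{B}}_{n,k}$ is its complement, whose edges are all $k$-subsets of $V$ meeting $A$ in an even number of vertices. For $k$-uniform hypergraphs $H,H'$ on $n$ vertices, $H$ is $\varepsilon$-close to $H'$ if there is an isomorphic copy $\tilde H$ of $H$ with $V(\tilde H)=V(H')$ and $|E(\tilde H)\triangle E(H')|\le\varepsilon n^k$. *)

(* Defs.v *)
From HB Require Import structures.
From mathcomp Require Import all_boot all_order all_algebra.
From mathcomp Require Import reals.

Set Implicit Arguments.
Unset Strict Implicit.
Unset Printing Implicit Defensive.

Import Order.TTheory GRing.Theory Num.Theory.

(* The vertex set is a subset of an ambient finite type, so that an induced
   subhypergraph lives over the same type as the original hypergraph. *)
Record hypergraph (T : finType) (k : nat) := Hypergraph {
  vertices : {set T};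
  edges : {set {set T}};
  edgesP : forall e, e \in edges -> e \subset vertices /\ #|e| = k
}.

Section Hypergraphs.
Variables (T : finType) (k : nat).
Implicit Types (H : hypergraph T k) (M : {set {set T}}) (W X : {set T}).

Definition degree H (v : T) : nat := #|[set e in edges H | v \in e]|.

(* No degree exceeds #|edges H|, so the starting value of the iterated minimum
   only matters when there are no vertices. *)
Definition min_degree H : nat :=
  \big[minn/#|edges H|]_(v in vertices H) degree H v.

Definition matching H M : Prop := M \subset edges H /\ trivIset M.

Definition perfect_matching H M : Prop :=
  matching H M /\ cover M = vertices H.

Lemma induced_edgesP H X e : e \in [set e in edges H | e \subset X] ->
  e \subset X /\ #|e| = k.
Proof. by rewrite inE => /andP[/edgesP[_ ek] eX]. Qed.

Definition induced H X : hypergraph T k := Hypergraph (@induced_edgesP H X).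

Definition absorbs H M W : Prop :=
  W \subset vertices H :\: cover M /\
  exists N, perfect_matching (induced H (cover M :|: W)) N.

Lemma parity_edgesP (b : bool) (V A : {set T}) e :
  e \in [set e : {set T} | [&& e \subset V, #|e| == k & odd #|e :&: A| == b]] ->
  e \subset V /\ #|e| = k.
Proof. by rewrite inE => /and3P[eV /eqP ek _]. Qed.

(* Edges: the k-subsets of V meeting A in an odd (b = true) or even
   (b = false) number of vertices. *)
Definition parity_hypergraph (b : bool) (V A : {set T}) : hypergraph T k :=
  Hypergraph (@parity_edgesP b V A).

End Hypergraphs.

(* The class A of the partition of 'I_n; the class B is ~: half n. *)
Definition half (n : nat) : {set 'I_n} := [set i : 'I_n | i < n./2].

Definition Bnk (n k : nat) : hypergraph 'I_n k :=
  parity_hypergraph k true [set: 'I_n] (half n).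

Definition Bnk_bar (n k : nat) : hypergraph 'I_n k :=
  parity_hypergraph k false [set: 'I_n] (half n).

Lemma card_half n : #|half n| = n./2.
Proof.
have le : n./2 <= n by rewrite -[leqRHS](odd_double_half n) -addnn addnA leq_addl.
rewrite -[RHS]card_ord -(@card_imset _ _ (widen_ord le)); last first.
  by move=> i j /(congr1 val)/= /val_inj.
apply: eq_card => i; rewrite inE; apply/idP/imsetP => [lt_i|[j _ ->]].
  by exists (Ordinal lt_i) => //; apply: val_inj.
exact: (ltn_ord j).
Qed.

Lemma card_halfC n : #|~: half n| = uphalf n.
Proof.
by apply: (@addnI n./2); rewrite -{1}card_half cardsC card_ord addnC uphalf_half
  -addnA addnn odd_double_half.
Qed.

Lemma edges_Bnk_bar n k :
  edges (Bnk_bar n k) = [set e : {set 'I_n} | #|e| == k] :\: edges (Bnk n k).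
Proof.
apply/setP => e; rewrite !inE subsetT /=.
by case: (#|e| == k); case: (odd _).
Qed.

(* The map f is only constrained on vertices H; restricted there it is a
   bijection onto vertices H'. *)
Definition isomorphic (T T' : finType) (k : nat)
    (H : hypergraph T k) (H' : hypergraph T' k) : Prop :=
  exists f : T -> T',
    [/\ {in vertices H &, injective f},
        f @: vertices H = vertices H'
      & edges H' = [set f @: e | e : {set T} in edges H] ].

Definition symdiff (T : finType) (E F : {set T}) : {set T} :=
  (E :\: F) :|: (F :\: E).

Local Open Scope ring_scope.

Definition close (R : realType) (eps : R) (T T' : finType) (k : nat)
    (H : hypergraph T k) (H' : hypergraph T' k) : Prop :=
  exists Ht : hypergraph T' k,
    [/\ isomorphic H Ht, vertices Ht = vertices H'
      & #|symdiff (edges Ht) (edges H')|%:R <= eps * #|vertices H'|%:R ^+ k ].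

(* Main.v *)
(** All densities are averages over independent uniformly random vertices.
Write h for the indicator of an edge on k-tuples and say that two vertices x, y
are linked when their links h(x, .) and h(y, .) share a positive proportion of
(k-1)-tuples, or when a positive proportion of the z have this property with
both x and y.

If some pair x0, y0 is not linked then, as all links have density about 1/2,
almost every link is close to the link of x0 or to its complement; let S be
the set of vertices of the second kind.  Adding to h the parity of the number of
entries in S makes it almost independent of its first entry, hence, by symmetry
and a hybrid argument, almost constant.  So H is close to a parity hypergraph
for S, and |S| is close to n/2 because the average of (-1)^(number of entries
in S) over (k-1)-tuples is (1 - 2|S|/n)^(k-1).

If all pairs are linked, every linked pair has a positive density of exchange
gadgets, so every k-set has a positive density c of absorbing tuples.  Tuples
are then selected greedily: with weight 2^-a on a k-set which has already been
given a absorbers, some tuple avoiding the previous ones halves the weights of a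
proportion c of the total weight, so that the total weight decays exponentially
and in the end every k-set has linearly many absorbers. *)

Require Import Defs.
From mathcomp Require Import all_boot all_order all_algebra.
From mathcomp Require Import reals.
From mathcomp Require Import ring lra zify.

Set Implicit Arguments.
Unset Strict Implicit.
Unset Printing Implicit Defensive.

Import Order.TTheory GRing.Theory Num.Theory.
Local Open Scope ring_scope.

(** * Averages over tuples of vertices *)

Section Average.
Variables (R : realFieldType) (T : finType) (V : {set T}).
Implicit Types (F G : seq T -> R) (m : nat) (s t : seq T) (x : T).

(** Entries are drawn independently, with repetition, so averages split over concatenation and can
    be exchanged; repeated entries cost only terms of order 1/|V|. *)
Fixpoint avg m F : R :=
  if m is m'.+1 then (\sum_(x in V) avg m' (fun s => F (x :: s))) / #|V|%:R
  else F [::].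

Definition prob m (p : pred (seq T)) : R := avg m (fun s => (p s)%:R).

Lemma avg0 F : avg 0 F = F [::].
Proof. by []. Qed.

Lemma avgS m F :
  avg m.+1 F = (\sum_(x in V) avg m (fun s => F (x :: s))) / #|V|%:R.
Proof. by []. Qed.

Lemma ler_avg m F G :
  (forall s, size s = m -> {subset s <= V} -> F s <= G s) ->
  avg m F <= avg m G.
Proof.
elim: m F G => [|m IH] F G leFG /=; first exact: leFG.
rewrite ler_wpM2r ?invr_ge0 ?ler0n // ler_sum // => x xV.
apply: IH => s sm sV; apply: leFG; first by rewrite /= sm.
by move=> y; rewrite inE => /predU1P[->|/sV].
Qed.

Lemma eq_avg m F G :
  (forall s, size s = m -> {subset s <= V} -> F s = G s) -> avg m F = avg m G.
Proof.
by move=> eqFG; apply/eqP; rewrite eq_le !ler_avg // => s sm sV; rewrite eqFG.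
Qed.

Lemma avgD m F G : avg m (fun s => F s + G s) = avg m F + avg m G.
Proof.
elim: m F G => //= m IH F G.
by rewrite -mulrDl -big_split; congr (_ / _); apply: eq_bigr => x _; exact: IH.
Qed.

Lemma avgZ m c F : avg m (fun s => c * F s) = c * avg m F.
Proof.
elim: m F => //= m IH F.
by rewrite mulrA mulr_sumr; congr (_ / _); apply: eq_bigr => x _; exact: IH.
Qed.

Lemma avgB m F G : avg m (fun s => F s - G s) = avg m F - avg m G.
Proof.
rewrite -[- avg m G]mulN1r -avgZ -avgD; apply: eq_avg => s _ _.
by rewrite mulN1r.
Qed.

Lemma avg_sum m (I : finType) (P : pred I) (F : I -> seq T -> R) :
  avg m (fun s => \sum_(i | P i) F i s) = \sum_(i | P i) avg m (F i).
Proof.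
elim: m F => //= m IH F.
rewrite -mulr_suml exchange_big /=; congr (_ / _); apply: eq_bigr => x _.
exact: (IH (fun i s => F i (x :: s))).
Qed.

Lemma avg_cat m1 m2 F :
  avg (m1 + m2) F = avg m1 (fun s => avg m2 (fun t => F (s ++ t))).
Proof.
elim: m1 F => //= m IH F.
by congr (_ / _); apply: eq_bigr => x _; rewrite IH.
Qed.

Lemma avg_exchange m1 m2 (F : seq T -> seq T -> R) :
  avg m1 (fun s => avg m2 (fun t => F s t)) =
  avg m2 (fun t => avg m1 (fun s => F s t)).
Proof.
elim: m1 F => //= m IH F.
under eq_bigr => x _ do rewrite (IH (fun s => F (x :: s))).
rewrite -avg_sum mulrC -avgZ; apply: eq_avg => s _ _; exact: mulrC.
Qed.

Lemma prob_ge0 m p : 0 <= prob m p.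
Proof.
rewrite /prob -(mul0r (avg m (fun=> 0))) -avgZ; apply: ler_avg => s _ _.
by rewrite mul0r ler0n.
Qed.

Lemma prob_mono m (p q : pred (seq T)) :
  (forall s, size s = m -> {subset s <= V} -> p s -> q s) ->
  prob m p <= prob m q.
Proof.
move=> pq; apply: ler_avg => s sm sV.
by rewrite ler_nat; case: (boolP (p s)) => // /(pq s sm sV) ->.
Qed.

Lemma probU m (p q : pred (seq T)) :
  prob m (fun s => p s || q s) <= prob m p + prob m q.
Proof.
rewrite -avgD; apply: ler_avg => s _ _.
by rewrite -natrD ler_nat; case: (p s) (q s) => [] [].
Qed.

Section NonEmpty.
Hypothesis V_gt0 : (0 < #|V|)%N.

Lemma avg_const m c : avg m (fun=> c) = c.
Proof.
elim: m => //= m ->.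
by rewrite sumr_const -[c *+ _]mulr_natr mulfK // pnatr_eq0 -lt0n.
Qed.

Lemma prob_le1 m p : prob m p <= 1.
Proof.
by rewrite -(avg_const m 1) ler_avg // => s _ _; rewrite lern1 leq_b1.
Qed.

(** Conditional expectations: entries are fixed one at a time, never letting the average over the
    remaining ones drop. *)
Lemma avg_witness m F :
  exists s, [/\ size s = m, {subset s <= V} & avg m F <= F s].
Proof.
elim: m F => [|m IH] F; first by exists [::].
pose G x := avg m (fun s => F (x :: s)).
have [x xV leG] : exists2 x, x \in V & avg m.+1 F <= G x.
  apply/exists_inP; apply: contraT; rewrite negb_exists_in => /forall_inP ltG.
  have /card_gt0P[x0 x0V] := V_gt0.
  suff : avg m.+1 F < avg m.+1 F by rewrite ltxx.
  rewrite [X in X < _]/= ltr_pdivrMr ?ltr0n // mulr_natr -sumr_const.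
  apply: ltr_sum => [|x xV]; last by rewrite ltNge ltG.
  by apply/hasP; exists x0; rewrite ?mem_index_enum.
have [s [sm sV leF]] := IH (fun s => F (x :: s)).
exists (x :: s); split; rewrite /= ?sm //; last exact: le_trans leF.
by move=> y; rewrite inE => /predU1P[->|/sV].
Qed.

Lemma prob_has m (U : {set T}) :
  prob m (has (mem U)) <= (m * #|U|)%:R / #|V|%:R.
Proof.
elim: m => [|m IH]; first by rewrite mul0n mul0r.
rewrite /prob /= mulSn natrD mulrDl.
apply: (@le_trans _ _ ((\sum_(x in V) ((x \in U)%:R + prob m (has (mem U))))
                        / #|V|%:R)).
  rewrite ler_wpM2r ?invr_ge0 ?ler0n // ler_sum // => x _.
  rewrite -(avg_const m (x \in U)%:R) -avgD; apply: ler_avg => s _ _.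
  by rewrite -natrD ler_nat; case: (x \in U); case: (has _ _).
rewrite big_split /= sumr_const -[_ *+ _]mulr_natr mulrDl mulfK; last first.
  by rewrite pnatr_eq0 -lt0n.
rewrite lerD // ler_wpM2r ?invr_ge0 ?ler0n // -natr_sum ler_nat.
rewrite -big_mkcondr /= sum1dep_card subset_leq_card //.
by apply/subsetP => x; rewrite inE => /andP[].
Qed.

Lemma prob_Nuniq m : prob m (fun s => ~~ uniq s) <= (m * m)%:R / #|V|%:R.
Proof.
elim: m => [|m IH]; first by rewrite mul0r.
pose p := prob m (fun s => ~~ uniq s).
apply: (@le_trans _ _ ((\sum_(x in V) (m%:R / #|V|%:R + p)) / #|V|%:R)).
  rewrite /prob /= ler_wpM2r ?invr_ge0 ?ler0n // ler_sum // => x _.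
  have := prob_has m [set x]; rewrite cards1 muln1 => h.
  apply: (@le_trans _ _ (prob m (has (mem [set x])) + p)); last first.
    by rewrite lerD2r.
  rewrite -avgD; apply: ler_avg => s _ _; rewrite -natrD ler_nat negb_and negbK.
  have -> : has (mem [set x]) s = (x \in s).
    by rewrite -has_pred1; apply: eq_has => y; rewrite /= inE.
  by case: (x \in s); case: (uniq s).
rewrite sumr_const -[_ *+ _]mulr_natr mulfK ?pnatr_eq0 -?lt0n //.
apply: (@le_trans _ _ (m%:R / #|V|%:R + (m * m)%:R / #|V|%:R)).
  by rewrite lerD2l.
rewrite -mulrDl -natrD ler_wpM2r ?invr_ge0 ?ler0n // ler_nat; lia.
Qed.

End NonEmpty.

(** Any element of [S] may come first, and the tail must then range over the remaining ones; this
    produces the factorial by induction. *)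
Lemma prob_eq_set m (S : {set T}) : #|S| = m -> S \subset V ->
  prob m (fun s => [set:: s] == S) = m`!%:R / #|V|%:R ^+ m.
Proof.
elim: m S => [|m IH] S Sm SV.
  rewrite /prob /= fact0 expr0 divr1; move/eqP: Sm; rewrite cards_eq0 => /eqP->.
  suff -> : [set:: [::]] = set0 :> {set T} by rewrite eqxx.
  by apply/setP => x; rewrite !inE.
rewrite /prob /= (bigID (mem S)) /= [X in _ + X]big1 ?addr0; last first.
  move=> x /andP[xV xS]; rewrite -(mul0r (avg m (fun=> 0))) -avgZ.
  apply: eq_avg => s _ _; rewrite mul0r; case: eqP => // eqS.
  by move: xS; rewrite -eqS !inE eqxx.
rewrite (eq_bigr (fun=> m`!%:R / #|V|%:R ^+ m)); last first.
  move=> x /andP[xV xS]; rewrite -(IH (S :\ x)); first last.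
  - by apply: subset_trans SV; rewrite subsetDl.
  - by have := cardsD1 x S; rewrite xS Sm => -[].
  apply: eq_avg => s sm sV; congr (_%:R); congr nat_of_bool.
  apply/eqP/eqP => [eqS|eqS].
    have xs : x \notin s.
      apply/negP => xs.
      have : (#|S| <= size s)%N.
        rewrite -eqS; apply: leq_trans (card_size s); apply: subset_leq_card.
        by apply/subsetP => y; rewrite !inE => /predU1P[->|].
      by rewrite Sm sm ltnn.
    apply/setP => y; rewrite -eqS !inE; case: eqP => [->|] //=.
    exact: negbTE.
  apply/setP => y; have /setP/(_ y) := eqS; rewrite !inE.
  by case: eqP => [-> _|_ -> //]; rewrite xS.
rewrite sumr_const.
have -> : #|[pred x | x \in V & x \in S]| = m.+1.
  rewrite -Sm; apply: eq_card => x; rewrite !inE.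
  by apply: andb_idl => /(subsetP SV).
rewrite factS natrM -[_ *+ _]mulr_natl exprS invfM mulrA; ring.
Qed.

(** This is the bridge between counts of sets (degrees, binomials, symmetric differences) and
    probabilities over tuples. *)
Lemma prob_mem_family m (D : {set {set T}}) :
  (forall S, S \in D -> #|S| = m /\ S \subset V) ->
  prob m (fun s => [set:: s] \in D) = #|D|%:R * m`!%:R / #|V|%:R ^+ m.
Proof.
move=> DP.
have -> : prob m (fun s => [set:: s] \in D) =
          \sum_(S in D) prob m (fun s => [set:: s] == S).
  rewrite -avg_sum; apply: eq_avg => s _ _; rewrite -natr_sum; congr (_%:R).
  rewrite -big_mkcondr /= sum1dep_card.
  have -> : [set x in D | [set:: s] == x] =
    if [set:: s] \in D then [set [set:: s]] else set0.
    apply/setP => S; rewrite inE; case: (eqVneq [set:: s] S) => [<-|nS].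
      by rewrite andbT; case: ifP; rewrite !inE ?eqxx.
    by rewrite andbF; case: ifP => _; rewrite !inE // eq_sym (negbTE nS).
  by case: ifP; rewrite ?cards1 ?cards0.
rewrite (eq_bigr (fun=> m`!%:R / #|V|%:R ^+ m)); last first.
  by move=> S /DP[]; exact: prob_eq_set.
by rewrite sumr_const -[_ *+ _]mulr_natl mulrA.
Qed.

End Average.

(* Unification must not unfold averages into big operators. *)
Opaque avg.

(** * Parity structure of unlinked hypergraphs *)

Section Parity.
Variables (T : finType) (Q : {set T}).

Definition parity (s : seq T) : bool := odd (count (mem Q) s).

Lemma parity_cons x s : parity (x :: s) = (x \in Q) (+) parity s.
Proof. by rewrite /parity /= oddD oddb. Qed.

Lemma parity_perm s t : perm_eq s t -> parity s = parity t.
Proof. by move=> /permP/(_ (mem Q)) eq_st; rewrite /parity eq_st. Qed.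

End Parity.

Section ParityStructure.
Variables (R : realFieldType) (T : finType) (V : {set T}).
Hypothesis V_gt0 : (0 < #|V|)%N.
Variables (k' : nat) (h : pred (seq T)).
Hypothesis h_perm : forall s t, perm_eq s t -> h s = h t.

Local Notation avg := (@avg R T V).
Local Notation prob := (@prob R T V).
Local Notation k := k'.+1.

Definition deg x : R := prob k' (fun s => h (x :: s)).
Definition codeg x y : R := prob k' (fun s => h (x :: s) && h (y :: s)).

Lemma avg_witness_le m F :
  exists s, [/\ size s = m, {subset s <= V} & F s <= avg m F].
Proof.
have [s [sm sV]] := avg_witness V_gt0 m (fun s => -1 * F s).
by rewrite avgZ !mulN1r lerN2; exists s.
Qed.

Lemma prob_links_eq x y :
  prob k' (fun s => h (x :: s) == h (y :: s)) =
  1 - deg x - deg y + 2 * codeg x y.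
Proof.
rewrite /deg /codeg /prob -avgZ -[X in X - _ - _](avg_const V_gt0 k').
rewrite -!avgB -avgD.
apply: eq_avg => s _ _.
by case: (h (x :: s)) (h (y :: s)) => [] [] /=; ring.
Qed.

(** The sign is a product of independent signs, one per entry, each of mean 1 - 2|Q|/|V|. *)
Lemma avg_sign_parity m (Q : {set T}) : Q \subset V ->
  avg m (fun s => (-1) ^+ parity Q s) =
  (1 - 2 * (#|Q|%:R / #|V|%:R)) ^+ m.
Proof.
move=> QV; have nV : #|V|%:R != 0 :> R by rewrite pnatr_eq0 -lt0n.
elim: m => [|m IH]; first by rewrite avg0 expr0.
rewrite avgS exprS -IH.
rewrite (eq_bigr (fun x => (1 - 2 * (x \in Q)%:R) *
                           avg m (fun s => (-1) ^+ parity Q s))); last first.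
  move=> x _; rewrite -avgZ; apply: eq_avg => s _ _.
  by rewrite parity_cons signr_addb; case: (x \in Q) => /=; ring.
rewrite -mulr_suml mulrAC; congr (_ * _).
rewrite sumrB sumr_const -mulr_sumr -natr_sum -big_mkcondr /= sum1dep_card.
have -> : [set x in V | x \in Q] = Q.
  by apply/setP => x; rewrite inE andb_idl // => /(subsetP QV).
by rewrite -mulr_natr; field.
Qed.

(* Hybrid argument: replace the entries of s by those of s' one at a time. *)
Lemma avg_hybrid (F : seq T -> bool) (theta : R) :
  (forall s t, perm_eq s t -> F s = F t) ->
  avg 1 (fun u => avg 1 (fun u' =>
    prob k' (fun t => F (u ++ t) != F (u' ++ t)))) <= theta ->
  forall j i, (i + j = k)%N ->
  avg j (fun s => avg j (fun s' =>
    prob i (fun t => F (s ++ t) != F (s' ++ t)))) <= j%:R * theta.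
Proof.
move=> F_perm leF; elim=> [|j IH] i ijk.
  rewrite mul0r !avg0 /prob (@eq_avg _ _ _ _ _ (fun=> 0)) ?avg_const //.
  by move=> s _ _; rewrite eqxx.
rewrite -[j.+1]add1n (@avg_cat R T V 1 j) natrD mulrDl mul1r.
pose G1 (u s u' t : seq T) : R := (F (u ++ s ++ t) != F (u' ++ s ++ t))%:R.
pose G2 (u' s s' t : seq T) : R :=
  (F (s ++ u' ++ t) != F (s' ++ u' ++ t))%:R.
(* The intermediate tuple is [u' ++ s ++ t]: [G1] changes only the first entry, with common tail
   [s ++ t], and [G2] changes [s] into [s'], where symmetry moves [u'] into the common tail. *)
apply: (@le_trans _ _ (avg 1 (fun u => avg j (fun s => avg 1 (fun u' => avg j
  (fun s' => avg i (fun t => G1 u s u' t + G2 u' s s' t))))))).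
  apply: ler_avg => u _ _.
  apply: ler_avg => s _ _.
  rewrite (@avg_cat R T V 1 j).
  apply: ler_avg => u' _ _; apply: ler_avg => s' _ _.
  apply: ler_avg => t _ _; rewrite /G1 /G2 -natrD ler_nat -!catA.
  rewrite (F_perm (s ++ u' ++ t) (u' ++ s ++ t)); last by rewrite perm_catCA.
  rewrite (F_perm (s' ++ u' ++ t) (u' ++ s' ++ t)); last by rewrite perm_catCA.
  by case: (F _) (F _) (F _) => [] [] [].
have -> : avg 1 (fun u => avg j (fun s => avg 1 (fun u' => avg j
  (fun s' => avg i (fun t => G1 u s u' t + G2 u' s s' t))))) =
  avg 1 (fun u => avg j (fun s => avg 1 (fun u' => avg i (G1 u s u')))) +
  avg j (fun s => avg 1 (fun u' => avg j (fun s' => avg i (G2 u' s s')))).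
  rewrite -[X in _ = _ + X](avg_const V_gt0 1) -avgD.
  apply: eq_avg => u _ _; rewrite -avgD; apply: eq_avg => s _ _.
  rewrite -avgD; apply: eq_avg => u' _ _.
  rewrite -[X in _ = X + _](avg_const V_gt0 j) -avgD.
  by apply: eq_avg => s' _ _; rewrite -avgD.
apply: lerD.
  apply: le_trans leF; apply: ler_avg => u _ _.
  rewrite avg_exchange; apply: ler_avg => u' _ _.
  by have -> : k' = (j + i)%N; [lia | rewrite /prob avg_cat].
apply: le_trans (IH i.+1 _); last by lia.
apply: ler_avg => s _ _; rewrite avg_exchange; apply: ler_avg => s' _ _.
by rewrite -[i.+1]add1n /prob avg_cat.
Qed.

Variables (mu : R) (x0 y0 : T).
Hypotheses (x0V : x0 \in V) (y0V : y0 \in V).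
Hypothesis deg_ge : forall x, x \in V -> 2^-1 - mu <= deg x.
Hypothesis codeg_x0y0 : codeg x0 y0 < mu.
Hypothesis few_connectors :
  #|[set z in V | (mu <= codeg x0 z) && (mu <= codeg z y0)]|%:R
  < mu * #|V|%:R.

Let Q := [set z in V | codeg x0 z < mu].

(** The vertices of [Q] are predicted to have the complement of the link of [x0], the others the
    link itself; [off] flags the tuples on which the prediction for the first entry fails. *)
Let off s := h s != h (x0 :: behead s) (+) (head x0 s \in Q).

(** By [prob_links_eq] the agreement is at most 1 - 2(1/2 - mu) + 2 mu. *)
Lemma links_opposite x y : x \in V -> y \in V -> codeg x y < mu ->
  prob k' (fun s => h (x :: s) == h (y :: s)) <= 4 * mu.
Proof.
move=> xV yV; rewrite prob_links_eq.
have := deg_ge xV; have := deg_ge yV; lra.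
Qed.

(** The connectors of [x0] and [y0] have total weight at most mu. A vertex of [Q] is opposite to
    [x0], with error 4 mu. Any other vertex is opposite to [y0], which is itself opposite to [x0],
    so the errors add up to 8 mu. *)
Lemma prob_off : prob k off <= 9 * mu.
Proof.
pose X := [set z in V | (mu <= codeg x0 z) && (mu <= codeg z y0)].
have n_gt0 : 0 < #|V|%:R :> R by rewrite ltr0n.
rewrite /prob avgS ler_pdivrMr //.
apply: (@le_trans _ _ (\sum_(v in V) (8 * mu + (v \in X)%:R))); last first.
  rewrite big_split /= sumr_const -[_ *+ _]mulr_natr.
  rewrite -natr_sum -big_mkcondr /= sum1dep_card.
  have -> : [set x in V | x \in X] = X.
    by apply/setP => x; rewrite !inE; case: (x \in V).
  by have := few_connectors; rewrite -/X; lra.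
apply: ler_sum => v vV; rewrite /off /=.
have mu_ge0 : 0 <= mu by apply: le_trans (ltW codeg_x0y0); exact: prob_ge0.
case: (boolP (v \in X)) => [vX|].
  by rewrite (le_trans (prob_le1 R V_gt0 k' _)) // lerDr; lra.
rewrite !inE vV /= negb_and -!ltNge addr0.
case: (ltP (codeg x0 v)) => /= [lt _|ge lt].
  apply: (@le_trans _ _ (4 * mu)); last by lra.
  apply: le_trans (links_opposite x0V vV lt).
  apply: prob_mono => s _ _.
  by case: (h (v :: s)) (h (x0 :: s)) => [] [].
apply: (@le_trans _ _ (4 * mu + 4 * mu)); last by lra.
apply: le_trans (lerD (links_opposite vV y0V lt)
                      (links_opposite x0V y0V codeg_x0y0)).
apply: le_trans (probU _ _ _ _ _).
apply: prob_mono => s _ _; rewrite addbF.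
by case: (h (v :: s)) (h (x0 :: s)) (h (y0 :: s)) => [] [] [].
Qed.

(** The set is [Q]. In the hybrid argument each of the [k] replacements costs two failures of the
    prediction, 9 mu each, whence 18 k mu. The balance of [Q] follows since the sign of the link of
    [x0] has mean near 0 and nearly agrees with the sign of the parity, up to the constant [c]. *)
Lemma parity_structure :
  exists (S : {set T}) (c : bool), [/\ S \subset V,
    prob k (fun s => h s != c (+) parity S s) <= 18 * k%:R * mu &
    `|1 - 2 * (#|S|%:R / #|V|%:R)| ^+ k' <= 60 * k%:R * mu].
Proof.
have mu_ge0 : 0 <= mu by apply: le_trans (ltW codeg_x0y0); exact: prob_ge0.
have QV : Q \subset V by apply/subsetP => x; rewrite inE => /andP[].
pose F s := h s (+) parity Q s.
have F_perm s t : perm_eq s t -> F s = F t.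
  by move=> st; rewrite /F (h_perm st) (parity_perm _ st).
(* When the prediction holds, this is the value of [F (v :: s)], whatever [v] is. *)
pose G s := h (x0 :: s) (+) parity Q s.
have F_off v s : (F (v :: s) != G s) ==> off (v :: s).
  rewrite /F /G /off /= parity_cons.
  by case: (h _) (h _) (v \in Q) (parity _ _) => [] [] [] [].
have hyb : avg k (fun s => avg k (fun s' =>
    prob 0 (fun t => F (s ++ t) != F (s' ++ t)))) <= k%:R * (18 * mu).
  apply: avg_hybrid => //.
  apply: (@le_trans _ _ (avg 1 (fun u => avg 1 (fun u' => avg k' (fun t =>
      (off (u ++ t))%:R + (off (u' ++ t))%:R))))).
    apply: ler_avg => -[|u []] // _ _; apply: ler_avg => -[|u' []] // _ _.
    apply: ler_avg => t _ _; rewrite -natrD ler_nat /=.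
    have := @F_off u t; have := @F_off u' t.
    by case: (F (u :: t)) (F (u' :: t)) (G t) (off (u :: t)) (off (u' :: t))
      => [] [] [] [] [].
  have e1 : avg 1 (fun u => avg k' (fun t => (off (u ++ t))%:R)) = prob k off.
    by rewrite /prob -[k]add1n (@avg_cat R T V 1 k').
  apply: (@le_trans _ _ (prob k off + prob k off)); last first.
    by have := prob_off; lra.
  rewrite le_eqVlt; apply/orP; left; apply/eqP.
  rewrite -{1}e1 -[X in _ + X](avg_const V_gt0 1) -avgD.
  apply: eq_avg => u _ _; rewrite -e1.
  rewrite -[X in X + _](avg_const V_gt0 1) -avgD.
  by apply: eq_avg => u' _ _; rewrite avgD.
rewrite avg_exchange in hyb.
(* Two random tuples rarely give different values of [F], so fixing the better-than-average one,
   [s0], makes [F] almost constantly [F s0]. *)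
have [s0 [_ _ le_s0]] := avg_witness_le k (fun s' => avg k (fun s =>
    prob 0 (fun t => F (s ++ t) != F (s' ++ t)))).
have [c Fc] : exists c, prob k (fun s => F s != c) <= k%:R * (18 * mu).
  exists (F s0); apply: le_trans (le_trans le_s0 hyb).
  by apply: ler_avg => s _ _; rewrite /prob avg0 !cats0.
have Gc : prob k' (fun s => G s != c) <= k%:R * (18 * mu) + 9 * mu.
  have -> : prob k' (fun s => G s != c) = prob k (fun s => G (behead s) != c).
    rewrite /prob -[k]add1n (@avg_cat R T V 1 k').
    rewrite -[LHS](avg_const V_gt0 1); apply: eq_avg => -[|u []] // _ _.
  apply: le_trans (lerD Fc prob_off).
  apply: le_trans (probU _ _ _ _ _).
  apply: prob_mono => -[|v s] // _ _ /=.
  have := @F_off v s.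
  by case: (F (v :: s)) (G s) (off _) c {Fc} => [] [] [] [].
exists Q, c; split=> //.
  apply: le_trans (_ : k%:R * (18 * mu) <= _); last first.
    by rewrite mulrA [18 * _]mulrC.
  apply: le_trans Fc; apply: prob_mono => s _ _; rewrite /F.
  by case: (h s) (parity Q s) c {Gc} => [] [] [].
have k_ge1 : 1 <= k%:R :> R by rewrite ler1n.
have kmu : mu <= k%:R * mu by rewrite ler_peMl.
have -> : `|1 - 2 * (#|Q|%:R / #|V|%:R)| ^+ k' =
          `|avg k' (fun s => (-1) ^+ c * (-1) ^+ parity Q s)|.
  by rewrite avgZ normrM normr_sign mul1r avg_sign_parity // normrX.
have sgn_h : avg k' (fun s => (-1) ^+ h (x0 :: s)) = 1 - 2 * deg x0.
  rewrite /deg /prob -avgZ -[X in X - _](avg_const V_gt0 k') -avgB.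
  by apply: eq_avg => s _ _; case: (h _) => /=; ring.
(* The links of [x0] and [y0] agree with nonnegative probability, so a lower bound on the density of
   one is an upper bound on that of the other. *)
have deg_x0_le : deg x0 <= 2^-1 + 3 * mu.
  have := prob_ge0 R V k' (fun s => h (x0 :: s) == h (y0 :: s)).
  by rewrite prob_links_eq; have := deg_ge y0V; have := codeg_x0y0; lra.
have deg_x0_ge := deg_ge x0V.
have close_sgn : `|avg k' (fun s => (-1) ^+ c * (-1) ^+ parity Q s) -
    avg k' (fun s => (-1) ^+ h (x0 :: s))| <= 2 * prob k' (fun s => G s != c).
  rewrite ler_norml -avgB -mulNr -!avgZ !ler_avg // => s _ _; rewrite /G.
    by case: (h _) (parity _ _) c {Fc Gc} => [] [] [] /=; lra.
  by case: (h _) (parity _ _) c {Fc Gc} => [] [] [] /=; lra.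
move: close_sgn; rewrite sgn_h !ler_norml => /andP[le1 le2].
move: kmu Gc; set kmu := k%:R * mu => kmu_ge Gc.
have -> : 60 * k%:R * mu = 60 * kmu by rewrite -mulrA.
have : k%:R * (18 * mu) = 18 * kmu by rewrite mulrCA.
(* The total is 2(18 k mu + 9 mu) + 6 mu, where 6 mu bounds |1 - 2 [deg x0]|; this is at most 60 k
   mu as k >= 1. *)
move=> eq18; rewrite eq18 in Gc; apply/andP; split; lra.
Qed.

End ParityStructure.

(** * Matchable sets and absorbers *)

Lemma prob_cat (R : realFieldType) (T : finType) (V : {set T}) m1 m2
    (p q : pred (seq T)) :
  prob R V (m1 + m2) (fun s => p (take m1 s) && q (drop m1 s)) =
  prob R V m1 p * prob R V m2 q.
Proof.
rewrite /prob avg_cat mulrC -avgZ; apply: eq_avg => s sm _.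
rewrite mulrC -avgZ; apply: eq_avg => t _ _.
by rewrite take_size_cat // drop_size_cat // -natrM mulnb.
Qed.

Section Matchable.
Variables (T : finType) (E : {set {set T}}).
Implicit Types (X Y : {set T}) (s t : seq T).

(** The boolean form allows absorbers to be counted inside set comprehensions. *)
Definition matchable X : bool :=
  [exists N : {set {set T}}, [&& N \subset E, trivIset N & cover N == X]].

Definition tuple_edge s : bool := [set:: s] \in E.

Lemma matchable0 : matchable set0.
Proof.
apply/existsP; exists set0; rewrite sub0set /cover big_set0 eqxx andbT /=.
by apply/trivIsetP => A B; rewrite inE.
Qed.

Lemma matchable_edge X : X \in E -> matchable X.
Proof.
move=> XE; apply/existsP; exists [set X].
by rewrite sub1set XE trivIset1 /cover big_set1 eqxx.
Qed.

Lemma matchableU X Y :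
  [disjoint X & Y] -> matchable X -> matchable Y -> matchable (X :|: Y).
Proof.
move=> dXY /existsP[M /and3P[ME tM /eqP cM]] /existsP[N /and3P[NE tN /eqP cN]].
have cMN : cover (M :|: N) = X :|: Y by rewrite /cover bigcup_setU -cM -cN.
apply/existsP; exists (M :|: N); apply/and3P; split; last exact/eqP.
  by rewrite subUset ME NE.
by apply: trivIsetU => //; rewrite cM cN.
Qed.

Lemma set_seq_cat s t : [set:: s ++ t] = [set:: s] :|: [set:: t].
Proof. by apply/setP => x; rewrite !inE mem_cat. Qed.

Lemma matchable_cat s t : uniq (s ++ t) ->
  matchable [set:: s] -> matchable [set:: t] -> matchable [set:: s ++ t].
Proof.
rewrite cat_uniq => /and3P[_ /hasPn dst _]; rewrite set_seq_cat.
apply: matchableU; rewrite disjoint_sym disjoint_subset.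
by apply/subsetP => x; rewrite !inE => /dst.
Qed.

Lemma perm_set_seq s t : perm_eq s t -> [set:: s] = [set:: t].
Proof. by move=> /perm_mem st; apply/setP => x; rewrite !inE st. Qed.

Lemma tuple_edge_perm s t : perm_eq s t -> tuple_edge s = tuple_edge t.
Proof. by rewrite /tuple_edge => /perm_set_seq->. Qed.

Lemma coverD1K (P : {set {set T}}) X : trivIset P -> X \in P ->
  cover P = X :|: cover (P :\ X) /\ [disjoint X & cover (P :\ X)].
Proof.
move=> tP XP; have XsubP : X \subset cover P by exact: bigcup_sup.
rewrite coverD1 //; split.
  by rewrite setDE setUIr setUCr setIT; apply/esym/setUidPr.
by rewrite disjoint_sym disjoints_subset setDE subsetIr.
Qed.

Lemma matchable_cover (P : {set {set T}}) :
  trivIset P -> {in P, forall X, matchable X} -> matchable (cover P).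
Proof.
move: {2}#|P| (erefl #|P|) => n; elim: n P => [|n IH] P Pn tP mP.
  move/eqP: Pn; rewrite cards_eq0 => /eqP->.
  by rewrite /cover big_set0 matchable0.
have /card_gt0P[X XP] : (0 < #|P|)%N by rewrite Pn.
have [-> dX] := coverD1K tP XP.
apply: matchableU => //; first exact: mP.
apply: IH; first by have := cardsD1 X P; rewrite XP Pn => -[].
  by apply: trivIsetS tP; exact: subD1set.
by move=> Y /setD1P[_ /mP].
Qed.

Lemma disjoint_setUl X Y (Z : {set T}) :
  [disjoint X :|: Y & Z] = [disjoint X & Z] && [disjoint Y & Z].
Proof. by rewrite -!setI_eq0 setIUl setU_eq0. Qed.

Lemma exists_subset_card (W : {set T}) k : (k <= #|W|)%N ->
  exists S : {set T}, S \subset W /\ #|S| = k.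
Proof.
rewrite -bin_gt0 -cards_draws => /card_gt0P[S].
by rewrite inE => /andP[SW /eqP Sk]; exists S.
Qed.

Definition absorber (S A : {set T}) : bool :=
  matchable A && matchable (A :|: S).

(** Cut off one [k]-subset of [W] at a time and spend one absorber on it: both the number of blocks
    left and the guaranteed number of absorbers drop by one. Members of [P] that are never spent are
    matched internally. *)
Lemma absorb_all (k q : nat) (P : {set {set T}}) (W : {set T}) :
  trivIset P -> {in P, forall A, matchable A} -> [disjoint W & cover P] ->
  #|W| = (q * k)%N ->
  (forall S : {set T}, S \subset W -> #|S| = k ->
    (q <= #|[set A in P | absorber S A]|)%N) ->
  matchable (cover P :|: W).
Proof.
elim: q P W => [|q IH] P W tP mP dWP Wq manyP.
  move/eqP: Wq; rewrite mul0n cards_eq0 => /eqP->.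
  by rewrite setU0 matchable_cover.
have [|S [SW Sk]] := @exists_subset_card W k.
  by rewrite Wq mulSn leq_addr.
have /card_gt0P[A] := leq_trans (ltn0Sn q) (manyP S SW Sk).
rewrite inE => /andP[AP /andP[mA mAS]].
have [eqP dAP] := coverD1K tP AP.
have -> : cover P :|: W = (A :|: S) :|: (cover (P :\ A) :|: W :\: S).
  by rewrite eqP setUACA -{1}(setID W S) (setIidPr SW).
move: dWP; rewrite eqP disjoint_sym disjoint_setUl => /andP[dAW dPW].
apply: matchableU => //; last first.
  apply: IH; first by apply: trivIsetS tP; exact: subD1set.
  - by move=> Y /setD1P[_ /mP].
  - by rewrite disjoint_sym; apply: disjointWr dPW; exact: subsetDl.
  - by rewrite cardsD (setIidPr SW) Wq Sk mulSn addKn.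
  move=> S' /subsetDP[S'W _] S'k; have := manyP S' S'W S'k.
  rewrite (cardsD1 A) => le; rewrite -ltnS; apply: leq_trans le _.
  rewrite -add1n leq_add ?leq_b1 // subset_leq_card //.
  by apply/subsetP => Y; rewrite !inE andbA.
rewrite disjoint_setUl !(disjoint_sym _ (_ :|: _)) !disjoint_setUl.
rewrite !(disjoint_sym _ A) !(disjoint_sym _ S) dAP /=; apply/and3P; split.
- by apply: disjointWr dAW; exact: subsetDl.
- by rewrite disjoint_sym; apply: disjointWr SW dPW.
- by rewrite disjoint_sym disjoints_subset setDE subsetIr.
Qed.

End Matchable.

(** * Exchange gadgets, absorbing tuples and their density *)

Section Gadgets.
Variables (T : finType) (E : {set {set T}}) (k' : nat).
Local Notation k := k'.+1.
Local Notation h := (tuple_edge E).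
Local Notation matchable := (matchable E).
Implicit Types (x y : T) (s t w : seq T).

(* With w = a ++ z :: b and |a| = |b| = k', either y completes a to an edge and
   z :: b is an edge, or x and y exchange through z. *)
Definition exchange x y w : bool :=
  let a := take k' w in let f := drop k' w in
  [&& h (x :: a), h f & h (y :: a) || h (head x f :: a) && h (y :: behead f)].

Lemma exchange_left x y w : exchange x y w -> uniq (x :: w) ->
  matchable [set:: x :: w].
Proof.
have -> : x :: w = (x :: take k' w) ++ drop k' w by rewrite /= cat_take_drop.
by move=> /and3P[hxa hf _] /matchable_cat; apply; exact: matchable_edge.
Qed.

Lemma exchange_right x y w : size w = (k' + k)%N -> exchange x y w ->
  uniq (y :: w) -> matchable [set:: y :: w].
Proof.
have -> : y :: w = (y :: take k' w) ++ drop k' w by rewrite /= cat_take_drop.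
move=> sw; rewrite /exchange.
have : size (drop k' w) = k by rewrite size_drop sw addKn.
case: (drop k' w) => // z b _; set a := take k' w.
case/and3P=> _ hf /orP[hya|/andP[hza hyb]].
  by move=> /matchable_cat; apply; exact: matchable_edge.
(* Exchange through [z]: now [z] completes [a], and [y] takes its place in front of [b]. *)
have eq_perm : perm_eq ((z :: a) ++ (y :: b)) (y :: a ++ z :: b).
  by apply/permP => p; rewrite /= !count_cat /=; lia.
rewrite -(perm_uniq eq_perm) -(perm_set_seq eq_perm).
by move=> /matchable_cat; apply; exact: matchable_edge.
Qed.

Fixpoint exchange_all ss es w : bool :=
  match ss, es with
  | x :: ss', y :: es' =>
      exchange x y (take (k' + k) w) && exchange_all ss' es' (drop (k' + k) w)
  | _, _ => true
  end.

Lemma exchange_all_left ss es w : size ss = size es ->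
  size w = (size ss * (k' + k))%N ->
  exchange_all ss es w -> uniq (ss ++ w) -> matchable [set:: ss ++ w].
Proof.
elim: ss es w => [|x ss IH] [|y es] w //=.
  move=> _ /size0nil-> _ _; suff -> : [set:: [::]] = set0 :> {set T}.
    exact: matchable0.
  by apply/setP => z; rewrite !inE.
move=> [sse] sw /andP[ex_xy ex_all].
set u := take (k' + k) w in ex_xy; set v := drop (k' + k) w in ex_all.
have eq_perm : perm_eq ((x :: u) ++ (ss ++ v)) (x :: ss ++ w).
  rewrite -(cat_take_drop (k' + k) w) -/u -/v.
  by apply/permP => p; rewrite /= !count_cat /=; lia.
move=> uq; have {}uq : uniq ((x :: u) ++ (ss ++ v)).
  by rewrite (perm_uniq eq_perm).
rewrite -(perm_set_seq eq_perm).
have := uq; rewrite cat_uniq => /and3P[uxu _ usv].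
apply: matchable_cat uq _ _; first exact: exchange_left ex_xy uxu.
by apply: IH ex_all usv; rewrite // size_drop sw mulSn addKn.
Qed.

Lemma exchange_all_right ss es w : size ss = size es ->
  size w = (size ss * (k' + k))%N ->
  exchange_all ss es w -> uniq (es ++ w) -> matchable [set:: es ++ w].
Proof.
elim: ss es w => [|x ss IH] [|y es] w //=.
  move=> _ /size0nil-> _ _; suff -> : [set:: [::]] = set0 :> {set T}.
    exact: matchable0.
  by apply/setP => z; rewrite !inE.
move=> [sse] sw /andP[ex_xy ex_all].
set u := take (k' + k) w in ex_xy; set v := drop (k' + k) w in ex_all.
have su : size u = (k' + k)%N by rewrite size_takel // sw mulSn leq_addr.
have eq_perm : perm_eq ((y :: u) ++ (es ++ v)) (y :: es ++ w).
  rewrite -(cat_take_drop (k' + k) w) -/u -/v.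
  by apply/permP => p; rewrite /= !count_cat /=; lia.
move=> uq; have {}uq : uniq ((y :: u) ++ (es ++ v)).
  by rewrite (perm_uniq eq_perm).
rewrite -(perm_set_seq eq_perm).
have := uq; rewrite cat_uniq => /and3P[uyu _ uev].
apply: matchable_cat uq _ _; first exact: exchange_right su ex_xy uyu.
by apply: IH ex_all uev; rewrite // size_drop sw mulSn addKn.
Qed.

(** One edge followed by [k] gadgets of 2k - 1 entries each, hence 2k^2 entries. *)
Definition gadget_size := (k + k * (k' + k))%N.

(* w = e ++ w_1 ++ ... ++ w_k with e an edge, and each w_i exchanges the i-th
   vertex of S with the i-th vertex of e. *)
Definition pre_absorber (S : {set T}) w : bool :=
  h (take k w) && exchange_all (enum S) (take k w) (drop k w).

Definition good_tuple (U S : {set T}) w : bool :=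
  [&& uniq w, ~~ has (mem U) w & absorber E S [set:: w]].

(** Without [S], each gadget is matched together with its vertex of [e]. With [S], each gadget takes
    its vertex of [S] instead, which frees [e] to be used as an edge. *)
Lemma pre_absorberP (S : {set T}) w : #|S| = k -> size w = gadget_size ->
  pre_absorber S w -> uniq w -> ~~ has (mem S) w -> absorber E S [set:: w].
Proof.
move=> Sk sw /andP[he ex_all] uw dwS; set e := take k w in he ex_all.
have se : size e = k by rewrite size_takel // sw leq_addr.
have sS : size (enum S) = k by rewrite -cardE.
have sv : size (drop k w) = (size (enum S) * (k' + k))%N.
  by rewrite sS size_drop sw addKn.
have uS : uniq (enum S ++ w).
  rewrite cat_uniq enum_uniq uw andbT /=; apply: contra dwS.
  by move/hasP => [x xw]; rewrite mem_enum => xS; apply/hasP; exists x.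
have eq_perm : perm_eq (e ++ (enum S ++ drop k w)) (enum S ++ w).
  rewrite -{2}(cat_take_drop k w) -/e.
  by apply/permP => p; rewrite !count_cat; lia.
rewrite /absorber; apply/andP; split.
  rewrite -(cat_take_drop k w); apply: exchange_all_right ex_all _ => //.
    by rewrite sS.
  by rewrite cat_take_drop.
have -> : [set:: w] :|: S = [set:: e ++ (enum S ++ drop k w)].
  by rewrite (perm_set_seq eq_perm); apply/setP => x;
    rewrite !inE mem_cat mem_enum orbC.
apply: matchable_cat; first by rewrite (perm_uniq eq_perm).
  exact: matchable_edge.
apply: exchange_all_left ex_all _ => //; first by rewrite sS.
by move: uS; rewrite -(perm_uniq eq_perm) cat_uniq => /and3P[].
Qed.

Section Probability.
Variables (R : realFieldType) (V : {set T}).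
Hypothesis V_gt0 : (0 < #|V|)%N.
Variable mu : R.
Hypotheses (mu_ge0 : 0 <= mu) (mu_le : mu <= 4^-1).
Local Notation avg := (@avg R T V).
Local Notation prob := (prob R V).
Local Notation deg := (deg R V k' h).
Local Notation codeg := (codeg R V k' h).

Hypothesis deg_ge : forall x, x \in V -> 4^-1 <= deg x.

Definition connectors x y :=
  [set z in V | (mu <= codeg x z) && (mu <= codeg z y)].

Hypothesis linked : forall x y, x \in V -> y \in V ->
  mu <= codeg x y \/ mu * #|V|%:R <= #|connectors x y|%:R.

Lemma prob_edge : 4^-1 <= prob k h.
Proof.
rewrite /prob avgS ler_pdivlMr ?ltr0n // mulr_natr -sumr_const.
exact: ler_sum.
Qed.

(** A direct link gives [mu] times the edge density, at least 1/4 and so at least mu^2. Otherwise a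
    proportion [mu] of the [z] each contribute the product of two codegrees, at least mu^2. *)
Lemma prob_exchange x y : x \in V -> y \in V ->
  mu ^+ 3 <= prob (k' + k) (exchange x y).
Proof.
move=> xV yV; have n_gt0 : 0 < #|V|%:R :> R by rewrite ltr0n.
have [codeg_ge|many] := linked xV yV.
  apply: (@le_trans _ _ (codeg x y * prob k h)).
    rewrite exprS ler_pM ?exprn_ge0 //; apply: le_trans prob_edge.
    rewrite expr2; apply: (@le_trans _ _ (4^-1 * 4^-1)); last by lra.
    exact: ler_pM.
  rewrite /codeg -prob_cat; apply: prob_mono => s _ _.
  by rewrite /exchange => /andP[/andP[-> ->] ->].
pose through z a b := [&& h (x :: a), h (z :: a), h (z :: b) & h (y :: b)].
(* Here [u] has the single entry [z]; treating it as a tuple lets its average be moved behind that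
   over [a], matching the order a, z, b in [exchange]. *)
apply: (@le_trans _ _ (avg 1 (fun u => avg k' (fun a => avg k' (fun b =>
   (all (fun z => through z a b) u)%:R))))).
  rewrite avgS ler_pdivlMr //.
  apply: (@le_trans _ _ (\sum_(z in V) mu ^+ 2 * (z \in connectors x y)%:R)).
    rewrite -mulr_sumr -natr_sum -big_mkcondr /= sum1dep_card.
    have -> : [set z in V | z \in connectors x y] = connectors x y.
      by apply/setP => z; rewrite !inE; case: (z \in V).
    by rewrite exprSr -mulrA ler_wpM2l ?exprn_ge0.
  apply: ler_sum => z zV; rewrite avg0.
  apply: (@le_trans _ _ (codeg x z * codeg z y)).
    rewrite inE zV /=; case: andP => [[le1 le2]|_].
      by rewrite mulr1 expr2 ler_pM.
    by rewrite mulr0 mulr_ge0 ?prob_ge0.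
  rewrite /codeg /prob mulrC -avgZ; apply: ler_avg => a _ _.
  rewrite mulrC -avgZ; apply: ler_avg => b _ _.
  rewrite -natrM mulnb /= andbT ler_nat /through.
  by case: (h _) (h _) (h _) (h _) => [] [] [] [].
rewrite avg_exchange /prob avg_cat; apply: ler_avg => a sa _.
rewrite -[k]add1n (@avg_cat R T V 1 k'); apply: ler_avg => -[|z []] // _ _.
apply: ler_avg => b _ _.
rewrite ler_nat /exchange /through take_size_cat // drop_size_cat //= andbT.
by case: (h _) (h _) (h _) (h _) (h _) => [] [] [] [] [].
Qed.

Lemma prob_exchange_all ss es : size ss = size es ->
  {subset ss <= V} -> {subset es <= V} ->
  (mu ^+ 3) ^+ size ss <= prob (size ss * (k' + k)) (exchange_all ss es).
Proof.
elim: ss es => [|x ss IH] [|y es] //=.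
move=> [sse] sV eV; rewrite mulSn prob_cat exprS ler_pM ?exprn_ge0 //.
  by apply: prob_exchange; [apply: sV | apply: eV]; rewrite mem_head.
by apply: IH => // z zs; [apply: sV | apply: eV]; rewrite inE zs orbT.
Qed.

(** The tuple [e] is an edge with probability at least 1/4, and given [e] the [k] gadgets are
    independent. *)
Lemma prob_pre_absorber (S : {set T}) : #|S| = k -> S \subset V ->
  4^-1 * (mu ^+ 3) ^+ k <= prob gadget_size (pre_absorber S).
Proof.
move=> Sk /subsetP SV; rewrite /gadget_size /prob avg_cat.
have c_ge0 : 0 <= (mu ^+ 3) ^+ k by rewrite !exprn_ge0.
apply: (@le_trans _ _ ((mu ^+ 3) ^+ k * prob k h)).
  by rewrite mulrC ler_wpM2l // prob_edge.
rewrite -avgZ; apply: ler_avg => e se eV.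
rewrite /pre_absorber; case he : (h e); last first.
  by rewrite mulr0; exact: (prob_ge0 R V _ (fun t => h (take k (e ++ t)) && _)).
rewrite mulr1; have sS : size (enum S) = k by rewrite -cardE.
have := @prob_exchange_all (enum S) e; rewrite sS => /(_ (esym se)) le.
apply: le_trans (le _ eV) _; first by move=> x; rewrite mem_enum => /SV.
apply: ler_avg => t _ _.
by rewrite take_size_cat // drop_size_cat // he.
Qed.

(** The subtracted term is a union bound for repeated entries and for entries in [U :|: S]. *)
Lemma prob_good_tuple (U S : {set T}) : #|S| = k -> S \subset V ->
  4^-1 * (mu ^+ 3) ^+ k
    - (gadget_size * (gadget_size + k + #|U|))%:R / #|V|%:R <=
  prob gadget_size (good_tuple U S).
Proof.
move=> Sk SV; set m := gadget_size; rewrite lerBlDr.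
apply: le_trans (prob_pre_absorber Sk SV) _.
apply: (@le_trans _ _ (prob m (good_tuple U S) +
   (prob m (fun w => ~~ uniq w) + prob m (has (mem (U :|: S)))))).
  rewrite -/m; apply: (@le_trans _ _ (prob m (fun w => good_tuple U S w ||
    (~~ uniq w || has (mem (U :|: S)) w)))).
    apply: prob_mono => w sw _ pw; rewrite /good_tuple.
    case: (boolP (uniq w)) => //= uw.
    case: (boolP (has (mem (U :|: S)) w)) => [|nUS]; first by rewrite !orbT.
    rewrite !orbF; apply/andP; split.
      by apply: contra nUS => /hasP[x xw xU]; apply/hasP; exists x;
        rewrite //= inE; apply/orP; left.
    apply: pre_absorberP => //.
    by apply: contra nUS => /hasP[x xw xU]; apply/hasP; exists x;
      rewrite //= inE; apply/orP; right.
  by apply: le_trans (probU _ _ _ _ _) _; rewrite lerD2l; exact: probU.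
rewrite lerD2l -addnA mulnDr natrD mulrDl lerD //; first exact: prob_Nuniq.
apply: le_trans (prob_has R V_gt0 m _) _.
rewrite ler_wpM2r ?invr_ge0 ?ler0n // ler_nat leq_mul2l addnC -Sk.
by rewrite (leq_trans (leq_card_setU U S)) ?orbT.
Qed.

End Probability.
End Gadgets.

(** * Greedy selection of absorbers *)

Section Selection.
Variables (R : realFieldType) (T : finType) (E : {set {set T}}) (V : {set T}).
Hypothesis V_gt0 : (0 < #|V|)%N.
Variables (k m N : nat) (c : R).
Hypotheses (m_gt0 : (0 < m)%N) (c_gt0 : 0 < c) (c_le1 : c <= 1).

Definition k_subsets : {set {set T}} :=
  [set S : {set T} | S \subset V & #|S| == k].

Hypothesis k_le : (k <= #|V|)%N.
Hypothesis prob_good : forall U S : {set T},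
  S \in k_subsets -> (#|U| <= N * m)%N ->
  c <= prob R V m (good_tuple E U S).

Definition absorber_count (P : {set {set T}}) S : nat :=
  #|[set A in P | absorber E S A]|.

(** Averaging over tuples weighted by the current sum yields a [w] that is good for [k]-sets
    carrying at least a fraction [c] of the weight. Adding it halves those weights, hence the factor
    1 - c/2. The vertices to avoid number at most N m throughout. *)
Lemma select_absorbers j : (j <= N)%N ->
  exists P : {set {set T}}, [/\ #|P| = j, trivIset P,
    forall A, A \in P -> [/\ #|A| = m, A \subset V & matchable E A] &
    \sum_(S in k_subsets) 2^-1 ^+ absorber_count P S
      <= (1 - c / 2) ^+ j * #|k_subsets|%:R].
Proof.
have c2_ge0 : 0 <= 1 - c / 2 by have := c_le1; lra.
elim: j => [|j IH] jN.
  exists set0; split; rewrite ?cards0 //.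
  - by apply/trivIsetP => A B; rewrite inE.
  - by move=> A; rewrite inE.
  rewrite expr0 mul1r -sum1_card natr_sum ler_sum // => S _.
  rewrite /absorber_count (_ : [set _ in _ | _] = set0) ?cards0 ?expr0 //.
  by apply/setP => A; rewrite !inE.
have [P [Pj tP PA le_sum]] := IH (ltnW jN).
pose wt S : R := 2^-1 ^+ absorber_count P S.
have wt_gt0 S : 0 < wt S by rewrite exprn_gt0 // invr_gt0 ltr0n.
have [S0 S0K] : exists S0, S0 \in k_subsets.
  have [S [SV Sk]] := exists_subset_card k_le.
  by exists S; rewrite inE SV Sk eqxx.
pose U := cover P.
have cardU : (#|U| <= N * m)%N.
  rewrite -(eqP (tP : trivIset P)).
  rewrite (eq_bigr (fun=> m)) => [|A /PA[]//].
  by rewrite sum_nat_const Pj leq_mul2r ltnW ?orbT.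
have [w [sw wV]] := avg_witness V_gt0 m
  (fun w => \sum_(S in k_subsets) wt S * (good_tuple E U S w)%:R).
rewrite avg_sum => le_w.
have {}le_w : c * (\sum_(S in k_subsets) wt S) <=
    \sum_(S in k_subsets) wt S * (good_tuple E U S w)%:R.
  apply: le_trans le_w; rewrite mulr_sumr ler_sum // => S SK.
  by rewrite avgZ mulrC ler_wpM2l ?(ltW (wt_gt0 S)) //; exact: prob_good.
have sum_gt0 : 0 < \sum_(S in k_subsets) wt S.
  rewrite (bigD1 S0) //= ltr_wpDr // sumr_ge0 // => S _; exact: ltW.
(* Being good for a single [S1] already gives what does not depend on the set: [w] has distinct
   entries, avoids [U] and is matchable. *)
have [S1 S1K good1] : exists2 S, S \in k_subsets & good_tuple E U S w.
  apply/exists_inP; apply: contraT; rewrite negb_exists_in => /forall_inP bad.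
  move: le_w; rewrite [X in _ <= X]big1 => [|S /bad/negbTE->]; last first.
    by rewrite mulr0.
  by rewrite leNgt mulr_gt0.
case/and3P: good1 => uw dwU /andP[mA _].
pose A := [set:: w].
have cardA : #|A| = m by rewrite cardsE; move/card_uniqP: uw => ->.
have AV : A \subset V by apply/subsetP => x; rewrite inE => /wV.
have dAU : [disjoint A & U].
  rewrite disjoint_subset; apply/subsetP => x; rewrite !inE => xw.
  by apply: contra dwU => xU; apply/hasP; exists x.
have AP : A \notin P.
  apply/negP => AP; have : A \subset U by exact: bigcup_sup.
  move=> /setIidPl AU; move: dAU; rewrite -setI_eq0 AU -cards_eq0 cardA.
  by case: (m) m_gt0.
exists (A |: P); split.
- by rewrite cardsU1 AP Pj.
- have tA : trivIset [set A] by exact: trivIset1.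
  by apply: trivIsetU => //; rewrite /cover big_set1.
- by move=> B /setU1P[->|/PA].
have wt_new S : 2^-1 ^+ absorber_count (A |: P) S <=
    wt S - 2^-1 * (wt S * (good_tuple E U S w)%:R) :> R.
  have -> : absorber_count (A |: P) S = (absorber E S A + absorber_count P S)%N.
    rewrite /absorber_count; case: (boolP (absorber E S A)) => aSA.
      rewrite (_ : [set _ in _ | _] = A |: [set B in P | absorber E S B]).
        by rewrite cardsU1 inE (negbTE AP).
      apply/setP => B; rewrite !inE.
      by case: (eqVneq B A) => [->|] //=; rewrite ?aSA.
    rewrite add0n; congr #|pred_of_set _|; apply/setP => B; rewrite !inE.
    by case: (eqVneq B A) => [->|] //=; rewrite (negbTE aSA) !andbF.
  rewrite exprD -/(wt S); have := wt_gt0 S.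
  rewrite /good_tuple -/A uw dwU /=.
  by case: (absorber E S A) => /=; rewrite ?expr0 ?expr1; lra.
apply: le_trans (ler_sum _ (fun S _ => wt_new S)) _.
rewrite sumrB -mulr_sumr exprS.
have : (1 - c / 2) * (\sum_(S in k_subsets) wt S) <=
       (1 - c / 2) * ((1 - c / 2) ^+ j * #|k_subsets|%:R).
  by apply: ler_wpM2l.
by rewrite -mulrA; apply: le_trans; lra.
Qed.

(** Every [Q] steps divide the total weight by 4, so after Q q steps it is at most 4^-q |V|^k <
    2^-q. A [k]-set with fewer than [q] absorbers would alone weigh at least 2^-q. *)
Lemma many_absorbers (Q q : nat) :
  (1 - c / 2) ^+ Q <= 4^-1 -> (#|V| ^ k < 2 ^ q)%N -> N = (Q * q)%N ->
  exists P : {set {set T}}, [/\ #|P| = N, trivIset P,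
    forall A, A \in P -> [/\ #|A| = m, A \subset V & matchable E A] &
    forall S : {set T}, S \subset V -> #|S| = k ->
      (q <= #|[set A in P | absorber E S A]|)%N].
Proof.
move: (c_gt0) (c_le1) => c0 c1 leQ ltq eN.
have [P [PN tP PA le_sum]] := select_absorbers (leqnn N).
exists P; split=> // S SV Sk; rewrite leqNgt; apply/negP => lt_q.
have SK : S \in k_subsets by rewrite inE SV Sk eqxx.
have half_ge0 : 0 <= 2^-1 :> R by rewrite invr_ge0 ler0n.
have le1 : 2^-1 ^+ q <= \sum_(S in k_subsets) 2^-1 ^+ absorber_count P S :> R.
  rewrite (bigD1 S) //= ler_wpDr ?sumr_ge0 // => [S' _|].
    exact: exprn_ge0.
  by rewrite ler_wiXn2l //; [lra | exact: ltnW].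
have le2 : (1 - c / 2) ^+ N <= (4^-1) ^+ q :> R.
  by rewrite eN exprM lerXn2r // nnegrE ?exprn_ge0 ?invr_ge0 ?ler0n //; lra.
have card_K : (#|k_subsets| <= #|V| ^ k)%N.
  rewrite cards_draws; apply: leq_trans (_ : #|V| ^_ k <= _)%N.
    by rewrite -bin_ffact leq_pmulr ?fact_gt0.
  by elim: (k) => // i IH; rewrite ffactnSr expnSr leq_mul ?leq_subr.
have : 2^-1 ^+ q <= (4^-1) ^+ q * (#|V| ^ k)%:R :> R.
  apply: le_trans le1 (le_trans le_sum _).
  by rewrite ler_pM ?ler_nat ?ler0n // exprn_ge0 //; lra.
have -> : 4^-1 ^+ q = 2^-1 ^+ q * 2^-1 ^+ q :> R.
  by rewrite -exprMn; congr (_ ^+ _); field.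
have p_gt0 : 0 < 2^-1 ^+ q :> R by rewrite exprn_gt0 // invr_gt0 ltr0n.
rewrite -mulrA -{1}[_ ^+ q]mulr1 ler_pM2l // exprVn mulrC.
rewrite ler_pdivlMr; last first.
  by rewrite exprn_gt0 ?ltr0n.
by rewrite mul1r -natrX ler_nat leqNgt ltq.
Qed.

End Selection.

(** * Degrees and closeness *)

Section Degrees.
Variables (R : realFieldType) (T : finType) (k' : nat).
Local Notation k := k'.+1.
Variable H : hypergraph T k.
Local Notation V := (vertices H).
Local Notation E := (edges H).
Hypothesis V_gt0 : (0 < #|V|)%N.

Lemma min_degree_le v : v \in V -> (min_degree H <= degree H v)%N.
Proof.
rewrite /min_degree => vV; have := mem_index_enum v.
elim: (index_enum T) => //= x s IH; rewrite inE big_cons => /predU1P[<-|/IH le].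
  by rewrite vV geq_minl.
by case: ifP => // _; rewrite geq_min le orbT.
Qed.

Lemma deg_tuple_edge v : v \in V ->
  deg R V k' (tuple_edge E) v = (degree H v)%:R * k'`!%:R / #|V|%:R ^+ k'.
Proof.
move=> vV; pose D := [set S : {set T} | (v \notin S) && (v |: S \in E)].
have DP S : S \in D -> #|S| = k' /\ S \subset V.
  rewrite inE => /andP[vS /edgesP[vSV]]; rewrite cardsU1 vS => -[Sk].
  by split=> //; apply: subset_trans vSV; exact: subsetUr.
have -> : degree H v = #|D|.
  rewrite /degree -(@card_in_imset _ _ (fun S => v |: S) D); last first.
    move=> S S'.
    rewrite !inE => /andP[vS _] /andP[vS' _] /(congr1 (fun X => X :\ v)).
    by rewrite !setU1K.
  apply: eq_card => e; rewrite inE; apply/andP/imsetP => [[eE ve]|[S]].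
    by exists (e :\ v); rewrite ?setD1K // inE setD11 setD1K.
  by rewrite inE => /andP[_ vSE] ->; rewrite setU11.
rewrite -prob_mem_family //; apply: eq_avg => s sk _.
rewrite /tuple_edge inE; congr (_%:R); congr nat_of_bool.
have -> : [set:: v :: s] = v |: [set:: s] by apply/setP => x; rewrite !inE.
(* A tail containing [v] spans too few vertices to form an edge with [v], so the condition that [v]
   is outside is automatic. *)
rewrite andb_idl // => /edgesP[_]; rewrite cardsU1; case: (v \notin _) => //.
have : (#|[set:: s]| <= k')%N by rewrite -sk cardsE card_size.
by rewrite add0n => + Sk; rewrite Sk ltnn.
Qed.

(** A tuple with distinct entries avoiding [v] ranges over a k'-subset of [V :\ v]; the exceptions
    have probability at most (k'^2 + k')/|V|. *)
Lemma binomial_density v : v \in V ->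
  1 - (k * k)%:R / #|V|%:R <=
  'C(#|V|.-1, k')%:R * k'`!%:R / #|V|%:R ^+ k' :> R.
Proof.
move=> vV; pose D := [set S : {set T} | (S \subset V :\ v) && (#|S| == k')].
have -> : 'C(#|V|.-1, k') = #|D| by rewrite cards_draws (cardsD1 v V) vV.
rewrite -prob_mem_family => [|S]; last first.
  by rewrite inE subsetD1 => /andP[/andP[SV _] /eqP].
rewrite lerBlDr.
apply: (@le_trans _ _ (prob R V k' (fun s => [set:: s] \in D) +
  (prob R V k' (fun s => ~~ uniq s) + prob R V k' (has (mem [set v]))))).
  rewrite -{1}(avg_const V_gt0 k' 1).
  apply: (@le_trans _ _ (prob R V k' (fun s => ([set:: s] \in D) ||
     (~~ uniq s || has (mem [set v]) s)))).
    apply: ler_avg => s sk sV; rewrite -[1]/(true%:R) ler_nat lt0b.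
    case: (boolP (uniq s)) => /= us; last by rewrite orbT.
    case: (boolP (has _ s)) => [|vs]; first by rewrite orbT.
    rewrite orbF inE subsetD1 cardsE (card_uniqP us) sk eqxx andbT.
    apply/andP; split; first by apply/subsetP => x; rewrite inE => /sV.
    rewrite inE; apply: contra vs => vs.
    by apply/hasP; exists v; rewrite //= inE.
  by apply: le_trans (probU _ _ _ _ _) _; rewrite lerD2l; exact: probU.
rewrite lerD2l.
apply: le_trans (lerD (prob_Nuniq R V_gt0 k') (prob_has R V_gt0 k' _)) _.
rewrite cards1 -mulrDl -natrD ler_wpM2r ?invr_ge0 ?ler0n // ler_nat; lia.
Qed.

Lemma deg_min_degree (a : R) v : a <= 2^-1 -> v \in V ->
  (2^-1 - a) * 'C(#|V|.-1, k')%:R <= (min_degree H)%:R ->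
  (2^-1 - a) * (1 - (k * k)%:R / #|V|%:R) <= deg R V k' (tuple_edge E) v.
Proof.
move=> a_le vV le_min; rewrite deg_tuple_edge //.
have X_ge0 : 0 <= k'`!%:R / #|V|%:R ^+ k' :> R.
  by rewrite divr_ge0 ?ler0n // exprn_ge0 ?ler0n.
apply: (@le_trans _ _ ((2^-1 - a) *
    ('C(#|V|.-1, k')%:R * k'`!%:R / #|V|%:R ^+ k'))).
  by rewrite ler_wpM2l ?subr_ge0 // (binomial_density vV).
rewrite -!mulrA mulrA ler_wpM2r //; apply: le_trans le_min _.
by rewrite ler_nat min_degree_le.
Qed.

End Degrees.

(** * From parity on random tuples to closeness *)

Section Closeness.
Variables (T : finType) (k : nat) (H : hypergraph T k).
Local Notation V := (vertices H).
Local Notation E := (edges H).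

(** The symmetric difference with a parity hypergraph, taken on the vertices of [H] themselves
    before any relabelling. *)
Definition mismatched (b : bool) (A : {set T}) : {set {set T}} :=
  [set e : {set T} | [&& e \subset V, #|e| == k
                       & (e \in E) != (odd #|e :&: A| == b)]].

(** Number the elements of [A] first and the other vertices after them. *)
Lemma exists_labelling (A : {set T}) (n : nat) :
  (0 < n)%N -> #|V| = n -> A \subset V -> #|A| = n./2 ->
  exists f : T -> 'I_n, [/\ {in V &, injective f}, f @: V = [set: 'I_n]
    & {in V, forall x, (f x \in Defs.half n) = (x \in A)}].
Proof.
case: n => // n' _ Vn AV An; pose l := enum A ++ enum (V :\: A).
have lV : l =i V.
  move=> x; rewrite mem_cat !mem_enum inE.
  by case: (boolP (x \in A)) => // /(subsetP AV).
have ul : uniq l.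
  rewrite cat_uniq !enum_uniq andbT /=; apply/hasPn => x.
  by rewrite !mem_enum inE => /andP[].
have sl : size l = n'.+1.
  by rewrite -Vn; move/card_uniqP: ul => <-; exact: eq_card.
pose f x : 'I_n'.+1 := inord (index x l).
have fE x : x \in V -> f x = index x l :> nat.
  by rewrite -lV => xl; rewrite inordK // -sl index_mem.
have f_inj : {in V &, injective f}.
  move=> x y xV yV /(congr1 val) /=; rewrite !fE // => eq_i.
  by rewrite -(nth_index x (_ : x \in l)) ?lV // eq_i nth_index // lV.
exists f; split => //.
  apply/eqP; rewrite eqEcard subsetT /= cardsT card_ord.
  by rewrite card_in_imset // Vn.
move=> x xV; rewrite inE fE // index_cat mem_enum -An cardE.
case: ifP => [xA|_]; first by rewrite index_mem mem_enum.
by rewrite ltnNge leq_addr.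
Qed.

Lemma close_parity (R : realType) (eps : R) (b : bool) (A : {set T}) :
  (0 < #|V|)%N -> A \subset V -> #|A| = #|V|./2 ->
  #|mismatched b A|%:R <= eps * #|V|%:R ^+ k ->
  close eps H (parity_hypergraph k b [set: 'I_#|V|] (Defs.half #|V|)).
Proof.
move=> V_gt0 AV An le_eps.
have [f [f_inj f_surj f_half]] := exists_labelling V_gt0 erefl AV An.
have f_card (e : {set T}) : e \subset V -> #|f @: e| = #|e|.
  move=> /subsetP eV; apply: card_in_imset => x y /eV xV /eV yV.
  exact: f_inj.
have f_cardA (e : {set T}) : e \subset V ->
    #|f @: e :&: Defs.half #|V| | = #|e :&: A|.
  move=> eV; rewrite -(f_card (e :&: A)); last first.
    by apply: subset_trans eV; exact: subsetIl.
  apply: eq_card => i; rewrite inE; apply/andP/imsetP.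
    case=> /imsetP[x xe ->]; rewrite f_half ?(subsetP eV) // => xA.
    by exists x; rewrite // inE xe.
  case=> x; rewrite inE => /andP[xe xA] ->.
  by rewrite imset_f // f_half ?(subsetP eV).
have HtP (e : {set 'I_#|V|}) : e \in [set f @: e | e : {set T} in E] ->
    e \subset [set: 'I_#|V|] /\ #|e| = k.
  by move=> /imsetP[e' /edgesP[e'V e'k] ->]; rewrite subsetT f_card.
exists (Hypergraph HtP); split=> //; first by exists f.
rewrite /= cardsT card_ord; apply: le_trans le_eps; rewrite ler_nat.
apply: leq_trans (leq_imset_card (fun e : {set T} => f @: e) _).
apply: subset_leq_card; apply/subsetP => e'; rewrite !inE.
case/orP => /andP[].
  move=> e'P /imsetP[e eE eq_e']; have [eV ek] := edgesP eE.
  apply/imsetP; exists e => //; rewrite inE eV ek eqxx eE /=.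
  by move: e'P; rewrite eq_e' subsetT f_card // ek eqxx f_cardA.
move=> e'P /and3P[_ /eqP e'k e'b].
pose e := [set x in V | f x \in e'].
have eV : e \subset V by apply/subsetP => x; rewrite inE => /andP[].
have fe : f @: e = e'.
  apply/setP => i; apply/imsetP/idP => [[x]|ie'].
    by rewrite inE => /andP[_ ?] ->.
  have : i \in f @: V by rewrite f_surj.
  by case/imsetP => x xV eq_i; exists x; rewrite // inE xV -eq_i.
apply/imsetP; exists e => //; rewrite inE eV -(f_card e) // fe e'k eqxx /=.
have -> : (e \in E) = false.
  by apply: contraNF e'P => eE; rewrite -fe imset_f.
by rewrite -f_cardA // fe e'b.
Qed.

Variable (R : realFieldType).

(** Each mismatched set comes from k! tuples, a factor bounded below by 1. The expression
    [~~ b (+) parity A s] says that the parity equals [b]. *)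
Lemma card_mismatched (b : bool) (A : {set T}) : (0 < #|V|)%N ->
  #|mismatched b A|%:R <= #|V|%:R ^+ k *
    prob R V k (fun s => tuple_edge E s != ~~ b (+) parity A s).
Proof.
move=> V_gt0; have n_gt0 : 0 < #|V|%:R ^+ k :> R by rewrite exprn_gt0 ?ltr0n.
rewrite mulrC -ler_pdivrMr //.
apply: (@le_trans _ _ (prob R V k (fun s => [set:: s] \in mismatched b A))).
  rewrite prob_mem_family => [|S]; last by rewrite inE => /and3P[SV /eqP].
  apply: ler_wpM2r; first by rewrite invr_ge0 ltW.
  by rewrite ler_peMr ?ler0n // ler1n fact_gt0.
apply: prob_mono => s sk _; rewrite inE /tuple_edge => /and3P[_ sk' neq].
have us : uniq s by apply/card_uniqP; rewrite sk -(eqP sk') cardsE.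
suff -> : parity A s = odd #|[set:: s] :&: A|.
  by move: neq; case: (_ \in _) (odd _) b => [] [] [].
congr odd; rewrite -size_filter; have uf : uniq (filter (mem A) s).
  exact: filter_uniq.
rewrite -(card_uniqP uf); apply: eq_card => x.
by rewrite !inE mem_filter andbC.
Qed.

(** Shrink or enlarge [S] to the exact size; the 1 absorbs the rounding of n/2. *)
Lemma exists_balanced (S : {set T}) (tau : R) : S \subset V ->
  (0 < #|V|)%N ->
  `|1 - 2 * (#|S|%:R / #|V|%:R)| <= tau ->
  exists A : {set T}, [/\ A \subset V, #|A| = #|V|./2 &
    #|(A :\: S) :|: (S :\: A)|%:R <= tau / 2 * #|V|%:R + 1].
Proof.
move=> SV V_gt0; set n := #|V| => le_tau.
have n_gt0 : 0 < n%:R :> R by rewrite ltr0n.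
have {}le_tau : `|n%:R - 2 * #|S|%:R| <= tau * n%:R.
  rewrite -ler_pdivrMr // -[n%:R^-1]gtr0_norm ?invr_gt0 // -normrM.
  by rewrite mulrBl divff ?gt_eqF // -mulrA.
move: le_tau; rewrite ler_norml => /andP[le1 le2].
have half_le : 2 * (n./2)%:R <= n%:R :> R by rewrite -natrM ler_nat; lia.
have half_ge : n%:R <= 2 * (n./2)%:R + 1 :> R.
  by rewrite -natrM natr1 ler_nat; lia.
have [le_half|lt_half] := leqP n./2 #|S|.
  have [A [AS An]] := exists_subset_card le_half.
  exists A; split=> //; first exact: subset_trans SV.
  have /eqP -> : A :\: S == set0 by rewrite setD_eq0.
  by rewrite set0U cardsD (setIidPr AS) An natrB //; lra.
have [B [BS Bn]] : exists B : {set T},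
    B \subset V :\: S /\ #|B| = (n./2 - #|S|)%N.
  apply: exists_subset_card; rewrite cardsD (setIidPr SV) -/n; lia.
have dSB : [disjoint S & B] by rewrite disjoint_sym; case/subsetDP: BS.
exists (S :|: B); split.
- by rewrite subUset SV (subset_trans BS) ?subsetDl.
- by rewrite cardsU (disjoint_setI0 dSB) cards0 subn0 Bn subnKC // ltnW.
have /eqP -> : S :\: (S :|: B) == set0 by rewrite setD_eq0 subsetUl.
have -> : (S :|: B) :\: S = B.
  by rewrite setDUl setDv set0U; apply/setDidPl; rewrite disjoint_sym.
by rewrite setU0 Bn natrB 1?ltnW //; lra.
Qed.

Lemma parity_symdiff (A S : {set T}) s :
  ~~ has (mem ((A :\: S) :|: (S :\: A))) s -> parity A s = parity S s.
Proof.
move=> /hasPn nD; congr odd; apply: eq_in_count => x /nD; rewrite /= !inE.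
by case: (x \in A) (x \in S) => [] [].
Qed.

End Closeness.

(** * Growth estimates *)

Lemma pow_lt_pow2 (L k : nat) : (0 < k)%N ->
  exists q1, forall q, (q1 <= q)%N -> ((L * q) ^ k < 2 ^ q)%N.
Proof.
(* With u the integer part of q/(2k), this threshold ensures u >= 2kL. Then L q <= u(u+1) < (u+1)^2,
   while (u+1)^(2k) <= 2^(2ku) <= 2^q. *)
move=> k_gt0; exists ((2 * k) * (2 * k * L))%N => q le_q.
have k2_gt0 : (0 < 2 * k)%N by rewrite muln_gt0.
pose u := (q %/ (2 * k))%N.
have u_ge : (2 * k * L <= u)%N by rewrite leq_divRL // mulnC.
apply: (@leq_trans (((u.+1) ^ 2) ^ k)%N).
  rewrite ltn_exp2r // expnS expn1.
  have := ltn_ceil q k2_gt0; rewrite -/u => lt_q.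
  have : (L * q <= L * (u.+1 * (2 * k)))%N by rewrite leq_mul2l ltnW ?orbT.
  have : (2 * k * L * u.+1 <= u * u.+1)%N by rewrite leq_mul2r u_ge orbT.
  nia.
apply: (@leq_trans (2 ^ (u * (2 * k)))).
  by rewrite -expnM [in leqRHS]expnM leq_exp2r // ltn_expl.
by rewrite leq_exp2l // leq_divM.
Qed.

Lemma expn_lt_exp2 (R : archiRealFieldType) (x : R) (k : nat) :
  0 < x -> (0 < k)%N -> exists n1, forall n q,
    (n1 <= n)%N -> x * n%:R < q%:R -> (n ^ k < 2 ^ q)%N.
Proof.
move=> x_gt0 k_gt0; pose L := (Num.bound x^-1).
have Lx : 1 < L%:R * x.
  by rewrite -ltr_pdivrMr // div1r archi_boundP // invr_ge0 ltW.
have [q1 growth] := pow_lt_pow2 L k_gt0.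
exists (L * q1)%N => n q le_n lt_q.
have lt_nLq : (n <= L * q)%N.
  rewrite -(ler_nat R) natrM; apply: (@le_trans _ _ (L%:R * (x * n%:R))).
    by rewrite mulrA ler_peMl ?ler0n // ltW.
  by rewrite ler_wpM2l ?ler0n // ltW.
apply: leq_ltn_trans (growth q _); first by rewrite leq_exp2r.
have L_gt0 : (0 < L)%N.
  by rewrite lt0n; apply: contraL Lx => /eqP->; rewrite mul0r -leNgt ler01.
by rewrite -(leq_pmul2l L_gt0); exact: leq_trans lt_nLq.
Qed.

Lemma exists_small_pow (R : archiRealFieldType) (x : R) : 0 < x -> x <= 1 ->
  exists Q : nat, (0 < Q)%N /\ (1 - x) ^+ Q <= 4^-1.
Proof.
(* Bernoulli gives (1 + x)^Q >= 1 + Q x >= 4, and (1 - x)(1 + x) <= 1. *)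
move=> x_gt0 x_le1; pose Q := Num.bound (3 / x).
have lt_Q : 3 / x < Q%:R by rewrite archi_boundP // divr_ge0 // ltW.
have Q_ge : 3 <= Q%:R * x by rewrite -ler_pdivrMr // ltW.
exists Q; split.
  by rewrite lt0n; apply: contraTN Q_ge => /eqP->; rewrite mul0r -ltNge.
have bernoulli j : 1 + j%:R * x <= (1 + x) ^+ j.
  elim: j => [|j IH]; first by rewrite mul0r addr0 expr0.
  rewrite exprS; apply: (@le_trans _ _ ((1 + x) * (1 + j%:R * x))).
    have : 0 <= j%:R * (x * x) by rewrite mulr_ge0 ?ler0n // mulr_ge0 // ltW.
    by rewrite -natr1; lra.
  by rewrite ler_wpM2l //; lra.
have pos : 0 < (1 + x) ^+ Q by rewrite exprn_gt0 //; lra.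
have : (1 - x) ^+ Q * (1 + x) ^+ Q <= 1.
  rewrite -exprMn exprn_ile1 //; nra.
have := bernoulli Q; have : 0 <= (1 - x) ^+ Q by rewrite exprn_ge0 //; lra.
nra.
Qed.

(** * The unlinked and the linked case *)

Lemma close_of_unlinked (R : realType) (T : finType) (k' : nat)
    (H : hypergraph T k'.+1) (eps mu tau : R) (x0 y0 : T) :
  (0 < #|vertices H|)%N -> (0 < k')%N -> 0 < tau ->
  60 * k'.+1%:R * mu <= tau ^+ k' ->
  18 * k'.+1%:R * mu + k'.+1%:R * (tau / 2 + #|vertices H|%:R^-1) <= eps ->
  x0 \in vertices H -> y0 \in vertices H ->
  (forall x, x \in vertices H ->
    2^-1 - mu <= deg R (vertices H) k' (tuple_edge (edges H)) x) ->
  codeg R (vertices H) k' (tuple_edge (edges H)) x0 y0 < mu ->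
  #|connectors (edges H) k' (vertices H) mu x0 y0|%:R
    < mu * #|vertices H|%:R ->
  close eps H (Bnk #|vertices H| k'.+1) \/
  close eps H (Bnk_bar #|vertices H| k'.+1).
Proof.
move=> V_gt0 k'_gt0 tau_gt0 mu_tau mu_eps x0V y0V deg_ge codeg_lt few.
set V := vertices H in V_gt0 mu_eps x0V y0V deg_ge codeg_lt few *.
set n := #|V|; have n_gt0 : 0 < n%:R :> R by rewrite ltr0n.
have [S [c [SV mism balanced]]] := parity_structure V_gt0
  (@tuple_edge_perm T (edges H)) x0V y0V deg_ge codeg_lt few.
(* Take k'-th roots; this is why [mu] is bounded by a power of [tau]. *)
have {}balanced : `|1 - 2 * (#|S|%:R / n%:R)| <= tau.
  rewrite -(ler_pXn2r k'_gt0) ?nnegrE ?(ltW tau_gt0) //.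
  exact: le_trans mu_tau.
have [A [AV An AS]] := exists_balanced SV V_gt0 balanced.
have le_A : #|mismatched H (~~ c) A|%:R <= eps * n%:R ^+ k'.+1.
  apply: le_trans (card_mismatched R (~~ c) A V_gt0) _.
  rewrite mulrC ler_wpM2r ?exprn_ge0 ?ler0n // negbK.
  apply: le_trans mu_eps.
  (* Replacing [S] by the balanced [A] matters only for tuples that meet [D], which costs at most
     k(tau/2 + 1/n). *)
  pose D := (A :\: S) :|: (S :\: A).
  apply: (@le_trans _ _ (prob R V k'.+1 (fun s =>
     tuple_edge (edges H) s != c (+) parity S s) +
     prob R V k'.+1 (has (mem D)))).
    apply: le_trans (probU _ _ _ _ _); apply: prob_mono => s _ _.
    case: (boolP (has (mem D) s)) => [|/parity_symdiff->]; last by rewrite orbF.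
    by rewrite orbT.
  apply: lerD => //; apply: le_trans (prob_has R V_gt0 _ _) _.
  rewrite natrM -mulrA ler_wpM2l ?ler0n // ler_pdivrMr //.
  by rewrite mulrDl mulVf ?gt_eqF.
have := close_parity V_gt0 AV An le_A.
(* Edges have parity [~~ c], so [c = true] is the even case. *)
by case: c {mism le_A} => ?; [right | left].
Qed.

(** Selecting Q q tuples gives every [k]-set at least [q] absorbers, more than the number of blocks
    in an admissible [W]. The 1/8 in [c] is half of the 1/4 in [prob_good_tuple]: the other half
    pays for avoiding vertices already used. *)
Lemma absorbing_of_linked (R : realType) (T : finType) (k' Q q : nat)
    (H : hypergraph T k'.+1) (mu c xi : R) :
  let n := #|vertices H| in
  let k := k'.+1 in
  let m := gadget_size k' in
  0 < mu -> mu <= 4^-1 -> c = 8^-1 * (mu ^+ 3) ^+ k ->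
  (forall x, x \in vertices H ->
    4^-1 <= deg R (vertices H) k' (tuple_edge (edges H)) x) ->
  (forall x y, x \in vertices H -> y \in vertices H ->
    mu <= codeg R (vertices H) k' (tuple_edge (edges H)) x y \/
    mu * #|vertices H|%:R <=
      #|connectors (edges H) k' (vertices H) mu x y|%:R) ->
  (1 - c / 2) ^+ Q <= 4^-1 -> (n ^ k < 2 ^ q)%N -> (k <= n)%N ->
  (m * (m + k) + Q * q * (m * m))%:R <= c * n%:R ->
  (Q * q * m)%:R <= xi * n%:R ->
  xi ^+ 2 * n%:R < q%:R ->
  exists M : {set {set T}},
    [/\ matching H M, #|M|%:R <= xi * n%:R / k%:R &
      forall W : {set T}, W \subset vertices H :\: cover M ->
        (0 < #|W|)%N -> (k %| #|W|)%N -> #|W|%:R <= xi ^+ 2 * n%:R ->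
        absorbs H M W].
Proof.
move=> n k m mu_gt0 mu_le cE deg_ge linked small_Q lt_q kn le_c le_xi lt_xi.
pose V := vertices H; rewrite -/V in deg_ge linked *.
have V_gt0 : (0 < #|V|)%N by apply: leq_trans kn.
have n_gt0 : 0 < n%:R :> R by rewrite ltr0n.
have mu3_le1 : (mu ^+ 3) ^+ k <= 1.
  by rewrite !exprn_ile1 ?exprn_ge0 ?(ltW mu_gt0) //; lra.
have mu3_gt0 : 0 < (mu ^+ 3) ^+ k by rewrite !exprn_gt0.
have c_gt0 : 0 < c by rewrite cE; lra.
have c_le1 : c <= 1 by rewrite cE; lra.
have good (U S : {set T}) : S \in k_subsets V k -> (#|U| <= Q * q * m)%N ->
    c <= prob R V m (good_tuple (edges H) U S).
  rewrite inE => /andP[SV /eqP Sk] leU.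
  have := prob_good_tuple V_gt0 (ltW mu_gt0) mu_le deg_ge linked U Sk SV.
  apply: le_trans.
  rewrite -/m -/k -/n.
  have : (m * (m + k + #|U|))%:R / n%:R <= c.
    rewrite ler_pdivrMr //; apply: le_trans le_c.
    by rewrite ler_nat mulnDr leq_add2l mulnA mulnC leq_mul2r leU orbT.
  by rewrite cE; lra.
have [P [PN tP PA absP]] :=
  many_absorbers V_gt0 (isT : (0 < m)%N) c_gt0 c_le1 kn good small_Q lt_q erefl.
have /existsP[M /and3P[ME tM /eqP cM]] : matchable (edges H) (cover P).
  by apply: matchable_cover => // A /PA[].
have cardM : (#|M| * k = Q * q * m)%N.
  have <- : #|cover M| = (#|M| * k)%N.
    rewrite -(eqP (tM : trivIset M)) (eq_bigr (fun=> k)) ?sum_nat_const //.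
    by move=> e /(subsetP ME)/edgesP[].
  rewrite cM -(eqP (tP : trivIset P)) (eq_bigr (fun=> m)) => [|A /PA[]//].
  by rewrite sum_nat_const PN.
exists M; split=> //.
  by rewrite ler_pdivlMr ?ltr0n // -natrM cardM.
move=> W WV _ /dvdnP[r Wr] le_W; split=> //.
have lt_r : (r < q)%N.
  rewrite -(ltr_nat R); apply: le_lt_trans lt_xi; apply: le_trans le_W.
  by rewrite Wr ler_nat leq_pmulr.
have [WsubV dWM] := subsetDP WV.
have /existsP[N /and3P[NE tN /eqP cN]] : matchable (edges H) (cover P :|: W).
  apply: (@absorb_all _ _ k r) => //; first by move=> A /PA[].
    by rewrite -cM.
  move=> S SW Sk; apply: leq_trans (ltnW lt_r) (absP S _ Sk).
  exact: subset_trans WsubV.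
exists N; split; last by rewrite /= cM.
split=> //; apply/subsetP => e eN; rewrite inE (subsetP NE) //= cM -cN.
exact: bigcup_sup.
Qed.

(** * Choice of parameters *)

Lemma eventually_le (R : archiRealFieldType) (a b : R) : 0 < b ->
  exists n0 : nat, forall n : nat, (n0 <= n)%N -> a <= b * n%:R.
Proof.
move=> b_gt0; exists (Num.bound (`|a| / b)) => n le_n.
rewrite mulrC -ler_pdivrMr //.
apply: (@le_trans _ _ (`|a| / b)).
  by rewrite ler_wpM2r ?invr_ge0 ?(ltW b_gt0) // ler_norm.
apply: ltW; apply: lt_le_trans (archi_boundP _) _.
  by rewrite divr_ge0 // ltW.
by rewrite ler_nat.
Qed.

(** Both error terms are small multiples of [tau], itself at most 1 so that its powers do not exceed
    it. The factor 3/4 leaves eps/4 for the rounding term k/n. *)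
Lemma exists_link_threshold (R : realFieldType) (eps : R) (k' : nat) :
  0 < eps -> (0 < k')%N ->
  exists tau mu : R, [/\ 0 < tau, 0 < mu, mu <= 8^-1, mu < eps &
    60 * k'.+1%:R * mu <= tau ^+ k' /\
    18 * k'.+1%:R * mu + k'.+1%:R * (tau / 2) <= 3 / 4 * eps].
Proof.
move=> eps_gt0 k'_gt0; set kR : R := k'.+1%:R.
have kR_ge2 : 2 <= kR by rewrite ler_nat.
pose e := Num.min eps 1.
have e_gt0 : 0 < e by rewrite lt_min eps_gt0 ltr01.
have e_le1 : e <= 1 by rewrite ge_min lexx orbT.
have e_eps : e <= eps by rewrite ge_min lexx.
have d_gt0 : 0 < 4 * kR by lra.
pose tau := e / (4 * kR); have tauE : tau * (4 * kR) = e.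
  by rewrite divfK // gt_eqF.
have tau_gt0 : 0 < tau by rewrite divr_gt0.
have tau_le : 8 * tau <= e.
  by rewrite -tauE mulrC; apply: ler_wpM2l; [exact: ltW | lra].
have f_gt0 : 0 < 60 * kR by lra.
pose mu := tau ^+ k' / (60 * kR); have muE : 60 * kR * mu = tau ^+ k'.
  by rewrite mulrC divfK // gt_eqF.
have mu_gt0 : 0 < mu by rewrite divr_gt0 ?exprn_gt0.
have tauk_le : tau ^+ k' <= tau.
  rewrite -(prednK k'_gt0) exprS ler_piMr ?(ltW tau_gt0) //.
  by rewrite exprn_ile1 ?(ltW tau_gt0) //; lra.
have mu_le : 2 * mu <= kR * mu by rewrite ler_wpM2r // ltW.
clearbody e tau mu kR.
exists tau, mu; split=> //; [lra | lra | split; lra].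
Qed.

(** The tuples use about Q m xi^2 n vertices, quadratic in [xi], so a small [xi] brings this below
    xi n. The choice of 8 [d] in the denominator gives 2 d xi^2 = (e c / 4) xi. *)
Lemma exists_absorption_rate (R : archiRealFieldType) (eps c : R) (m : nat) :
  0 < eps -> 0 < c -> c <= 1 -> (0 < m)%N ->
  exists (Q : nat) (xi : R), [/\ 0 < xi, xi < eps, (1 - c / 2) ^+ Q <= 4^-1 &
    forall n q : nat, q%:R <= 2 * (xi ^+ 2 * n%:R) ->
      (Q * q * (m * m))%:R <= c / 2 * n%:R /\
      (Q * q * m)%:R <= xi * n%:R].
Proof.
move=> eps_gt0 c_gt0 c_le1 m_gt0.
have [||Q [Q_gt0 small_Q]] := @exists_small_pow R (c / 2); [lra | lra |].
pose e := Num.min eps 1.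
have e_gt0 : 0 < e by rewrite lt_min eps_gt0 ltr01.
have e_le1 : e <= 1 by rewrite ge_min lexx orbT.
have e_eps : e <= eps by rewrite ge_min lexx.
pose d : R := (Q * (m * m))%:R.
have d_ge1 : 1 <= d by rewrite ler1n !muln_gt0 Q_gt0 m_gt0.
have d8_gt0 : 0 < 8 * d by lra.
have ec_gt0 : 0 < e * c by rewrite mulr_gt0.
have ec_le : e * c <= e by rewrite ler_piMr // ltW.
have ec_lec : e * c <= c by rewrite ler_piMl // ltW.
pose xi := e * c / (8 * d); have xiE : xi * (8 * d) = e * c.
  by rewrite divfK // gt_eqF.
have xi_gt0 : 0 < xi by rewrite divr_gt0.
have xi_d : xi <= xi * d by rewrite ler_peMr // ltW.
exists Q, xi; split=> // [|n q q_le]; first by clearbody xi d e; lra.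
have n_ge0 : 0 <= n%:R :> R by [].
have xin_ge0 : 0 <= xi * n%:R by rewrite mulr_ge0 // ltW.
have le_d : (Q * q * (m * m))%:R <= e * c / 4 * (xi * n%:R).
  have -> : e * c / 4 * (xi * n%:R) = d * (2 * (xi ^+ 2 * n%:R)).
    by rewrite -xiE; field.
  rewrite mulnAC natrM ler_wpM2l //; exact: le_trans d_ge1.
have xin_le : xi * n%:R <= n%:R by rewrite ler_piMl //; clearbody xi d e; lra.
split; apply: le_trans (_ : (Q * q * (m * m))%:R <= _); rewrite ?lexx //.
- apply: le_trans le_d _; apply: (@le_trans _ _ (e * c / 4 * n%:R)).
    by apply: ler_wpM2l => //; lra.
  by apply: ler_wpM2r => //; lra.
- by rewrite ler_nat !leq_mul2l leq_pmulr ?orbT.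
- apply: le_trans le_d _; rewrite ler_piMl //; lra.
Qed.

Theorem theorem5 (R : realType) (eps : R) (k : nat) (eps_gt0 : 0 < eps)
    (k_ge2 : (2 <= k)%N) :
  exists (alpha xi : R) (n0 : nat),
    [/\ 0 < alpha < eps, 0 < xi < eps, (0 < n0)%N &
    forall (n : nat) (T : finType) (H : hypergraph T k),
      #|vertices H| = n -> (n0 <= n)%N ->
      (2^-1 - alpha) * 'C(n.-1, k.-1)%:R <= (min_degree H)%:R ->
      [\/ close eps H (Bnk n k),
          close eps H (Bnk_bar n k) |
          exists M : {set {set T}},
            [/\ matching H M,
                #|M|%:R <= xi * n%:R / k%:R &
                forall W : {set T},
                  W \subset vertices H :\: cover M ->
                  (0 < #|W|)%N -> (k %| #|W|)%N ->
                  #|W|%:R <= xi ^+ 2 * n%:R ->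
                  absorbs H M W] ] ].
Proof.
case: k k_ge2 => [//|k'] k'_gt0; set k := k'.+1.
have [tau [mu [tau_gt0 mu_gt0 mu_le8 mu_eps [mu_tau mu_tau_eps]]]] :=
  exists_link_threshold eps_gt0 k'_gt0.
have mu3_gt0 : 0 < (mu ^+ 3) ^+ k by rewrite !exprn_gt0.
have mu3_le1 : (mu ^+ 3) ^+ k <= 1.
  by rewrite !exprn_ile1 ?exprn_ge0 ?(ltW mu_gt0) //; lra.
have [c cE] : exists c, c = 8^-1 * (mu ^+ 3) ^+ k by eexists.
have c_gt0 : 0 < c by rewrite cE; lra.
have c_le1 : c <= 1 by rewrite cE; lra.
pose m := gadget_size k'; have m_gt0 : (0 < m)%N by [].
have [Q [xi [xi_gt0 xi_eps small_Q rate]]] :=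
  exists_absorption_rate eps_gt0 c_gt0 c_le1 m_gt0.
have xi2_gt0 : 0 < xi ^+ 2 by rewrite exprn_gt0.
have [n1 growth] := expn_lt_exp2 xi2_gt0 (ltn0Sn k').
have [n2 large_mu] := eventually_le (2 * (k * k)%:R) mu_gt0.
have [n3 large_c] := eventually_le (2 * (m * (m + k))%:R) c_gt0.
have [n4 large_xi] := eventually_le 1 xi2_gt0.
have [n5 large_eps] := eventually_le (4 * k%:R) eps_gt0.
(* Half of [mu] is the degree deficit; the other half pays for k^2/n when the binomial is turned
   into a density of tuples. *)
exists (mu / 2), xi, (\max_(i <- [:: k; n1; n2; n3; n4; n5]) i)%N; split.
- by apply/andP; split; lra.
- by apply/andP; split.
- by rewrite big_cons leq_max.
move=> n T H <- {n}; set n := #|vertices H|.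
rewrite !big_cons big_nil !geq_max.
case/and5P=> kn n1n n2n n3n /and3P[n4n n5n _] deg_min.
have V_gt0 : (0 < #|vertices H|)%N by apply: leq_trans kn.
have n_gt0 : 0 < n%:R :> R by rewrite ltr0n.
have deg_ge x : x \in vertices H ->
    2^-1 - mu <= deg R (vertices H) k' (tuple_edge (edges H)) x.
  move=> xV; have mu2 : mu / 2 <= 2^-1 by lra.
  apply: le_trans (deg_min_degree V_gt0 mu2 xV deg_min).
  have : (k * k)%:R / n%:R <= mu / 2.
    by rewrite ler_pdivrMr //; have := large_mu n n2n; lra.
  have : 0 <= (k * k)%:R / n%:R :> R by rewrite divr_ge0 ?ler0n.
  rewrite -/n -/k; move: (_ / n%:R) mu_gt0 mu_le8 => y; clear; nra.
pose linked x y :=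
  (mu <= codeg R (vertices H) k' (tuple_edge (edges H)) x y) ||
  (mu * n%:R <= #|connectors (edges H) k' (vertices H) mu x y|%:R).
have [/forall_inP all_linked|] := boolP [forall (x | x \in vertices H),
    [forall (y | y \in vertices H), linked x y]]; last first.
  rewrite negb_forall_in => /exists_inP[x0 x0V].
  rewrite negb_forall_in => /exists_inP[y0 y0V].
  rewrite negb_or -!ltNge => /andP[codeg_lt few].
  suff small : 18 * k%:R * mu + k%:R * (tau / 2 + n%:R^-1) <= eps.
    have [] := close_of_unlinked V_gt0 k'_gt0 tau_gt0 mu_tau small x0V y0V
      deg_ge codeg_lt few; [by constructor 1 | by constructor 2].
  have : k%:R * n%:R^-1 <= eps / 4.
    by rewrite ler_pdivrMr //; have := large_eps n n5n; lra.
  rewrite mulrDr; move: (k%:R / n%:R) mu_tau_eps => y; rewrite -/k; clear.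
  lra.
constructor 3.
(* The least integer above xi^2 n, at most twice that number because [n4] makes it at least 1. *)
have [q [lt_q q_le]] : exists q : nat,
    xi ^+ 2 * n%:R < q%:R /\ q%:R <= 2 * (xi ^+ 2 * n%:R).
  move: (xi ^+ 2 * n%:R) (large_xi n n4n) => x x_ge1.
  exists (Num.truncn x).+1; split; first exact: truncnS_gt.
  have : (Num.truncn x)%:R <= x by rewrite truncn_le (le_trans ler01).
  by move: x_ge1; clear; rewrite -natr1; lra.
have [rate_c rate_xi] := rate n q q_le.
apply: (absorbing_of_linked mu_gt0 _ cE _ _ small_Q _ kn) => //.
- lra.
- by move=> x xV; apply: le_trans (deg_ge x xV); lra.
- by move=> x y xV yV; apply/orP; exact: (forall_inP (all_linked x xV) y yV).
- exact: (growth n q n1n lt_q).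
- have le_m : (m * (m + k))%:R <= c / 2 * n%:R.
    by have := large_c n n3n; lra.
  rewrite natrD; apply: le_trans (lerD le_m rate_c) _.
  by rewrite -mulrDl -splitr.
- exact: rate_xi.
- exact: lt_q.
Qed.
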